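(* Let $\Gamma=\mathrm{Cay}(G,S)$ be one of the graphs $\mathcal{CGD}^1_{p^2}$ ($p=5$ or $5\mid p-1$), $\mathcal{CGD}^2_{p^2}$ ($5\mid p\pm1$), $\mathcal{CGD}_{p^3}$ ($p=5$ or $5\mid p-1$), $\mathcal{CGD}_{p^4}$ ($p$ any prime). Let $P$ be a Sylow $p$-subgroup of $R(G)$ and $A=\mathrm{Aut}(\Gamma)$. Then $\Gamma$ is $N_A(P)$-arc-transitive. Moreover: (1) If $\Gamma=\mathcal{CGD}^1_{p^2}$: for $p=5$, $N_A(R(GD_{5^2}))\cong R(GD_{5^2})\rtimes F_{20}$; for $5\mid p-1$, $N_A(R(GD_{p^2}))\cong R(GD_{p^2})\rtimes\mathbb{Z}_5$; and $|N_A(P)|\ne 20p^2$. (2) If $\Gamma=\mathcal{CGD}^2_{p^2}$: $N_A(R(GD_{p^2}))\cong R(GD_{p^2})\rtimes D_5$ and $20p^2$ divides $|N_A(P)|$. (3) If $\Gamma=\mathcal{CGD}_{p^3}$: for $p=5$, $N_A(R(GD_{5^3}))\cong R(GD_{5^3})\rtimes S_5$; for $5\mid p-1$, $R(GD_{p^3})\rtimes\mathbb{Z}_5\le N_A(R(GD_{p^3}))$. (4) If $\Gamma=\mathcal{CGD}_{p^4}$: $N_A(R(GD_{p^4}))\cong R(GD_{p^4})\rtimes S_5$.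
   Context: For a group $G$ and $S\subseteq G$ with $1\notin S=S^{-1}$, $\mathrm{Cay}(G,S)$ has vertex set $G$ and edges $\{g,sg\}$; $R(G)\le\mathrm{Aut}(\mathrm{Cay}(G,S))$ is the right regular representation. For $H\le\mathrm{Aut}(\Gamma)$, $\Gamma$ is $H$-arc-transitive if $H$ is transitive on arcs. $N_A(X)$ denotes the normalizer in $A$. $D_5$ is dihedral of order 10, $F_{20}$ the Frobenius group of order 20. Exponents are computed in $\mathbb{Z}_p$. Let $\ell=1$ if $p=5$ and $\ell$ be an element of order 5 in $\mathbb{Z}_p^*$ if $5\mid p-1$. $GD_{p^2}=\langle a,d,h\mid a^p=d^p=h^2=[a,d]=1,\ h^{-1}ah=a^{-1},\ h^{-1}dh=d^{-1}\rangle$; $\mathcal{CGD}^1_{p^2}=\mathrm{Cay}(GD_{p^2},\{h,ah,a^{\ell(\ell+1)^{-1}}d^{\ell^{-1}}h,a^{\ell}d^{(\ell+1)^{-1}}h,dh\})$; for $5\mid p\pm1$ and $\lambda\in\mathbb{Z}_p^*$ with $\lambda^2=5$, $\mathcal{CGD}^2_{p^2}=\mathrm{Cay}(GD_{p^2},\{h,ah,a^{2^{-1}(1+\lambda)}dh,ad^{2^{-1}(1+\lambda)}h,dh\})$. $GD_{p^3}=\langle a,b,d,h\rangle$, $a,b,d$ generating elementary abelian $\mathbb{Z}_p^3$, $h^2=1$, $h^{-1}xh=x^{-1}$ ($x=a,b,d$); $\mathcal{CGD}_{p^3}=\mathrm{Cay}(GD_{p^3},\{h,ah,bh,a^{-\ell^2}b^{-\ell}d^{-\ell^{-1}}h,dh\})$.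 $GD_{p^4}=\langle a,b,c,d,h\rangle$, $a,b,c,d$ generating elementary abelian $\mathbb{Z}_p^4$, $h^2=1$, $h^{-1}xh=x^{-1}$; $\mathcal{CGD}_{p^4}=\mathrm{Cay}(GD_{p^4},\{h,ah,bh,ch,dh\})$. *)

(* Defs.v *)
From HB Require Import structures.
From mathcomp Require Import all_boot all_order all_algebra all_fingroup.
From mathcomp Require Import all_solvable.

Set Implicit Arguments.
Unset Strict Implicit.
Unset Printing Implicit Defensive.

Import GRing.Theory.

(* The generalized dihedral group of 'F_p^n, realized as 'F_p^n : Z_2 where  *)
(* the nontrivial element of Z_2 acts by inversion. For p prime, 'F_p is Z_p. *)
Definition GD (p n : nat) : Type := ('rV['F_p]_n * bool)%type.

Section GeneralizedDihedral.

Variables p n : nat.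
Local Open Scope ring_scope.
Implicit Types x y : GD p n.

Definition GD_mul x y : GD p n :=
  (x.1 + (-1) ^+ x.2 *: y.1, x.2 (+) y.2).
Definition GD_one : GD p n := (0, false).
Definition GD_inv x : GD p n := (- ((-1) ^+ x.2 *: x.1), x.2).

Fact GD_mulA : associative GD_mul.
Proof.
case=> u s [v t] [w r]; rewrite /GD_mul /= addbA scalerDr scalerA addrA.
by rewrite signr_addb.
Qed.

Fact GD_mul1 : left_id GD_one GD_mul.
Proof. by case=> u s; rewrite /GD_mul /= expr0 scale1r add0r. Qed.

Fact GD_mulV : left_inverse GD_one GD_inv GD_mul.
Proof. by case=> u s; rewrite /GD_mul /= addNr addbb. Qed.

HB.instance Definition _ := Finite.on (GD p n).
HB.instance Definition _ :=
  Finite_isGroup.Build (GD p n) GD_mulA GD_mul1 GD_mulV.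

Definition GD_gen (k : nat) : GD p n := (\row_(j < n) (j == k :> nat)%:R, false).
Definition GD_h : GD p n := (0, true).

End GeneralizedDihedral.

Local Open Scope group_scope.

(* With these generators, GD p 2 is the finitely presented group GD_{p^2}.    *)
Section Presentation.

Variable p : nat.
Hypothesis p_pr : prime p.

Let Fp_p : (Zp_trunc (pdiv p)).+2 = p.
Proof. by rewrite pdiv_id // Zp_cast // prime_gt1. Qed.

Fact GD_mulE n (x y : GD p n) : x * y = GD_mul x y. Proof. by []. Qed.

Fact GD_genX n k m :
  GD_gen p n k ^+ m = (m%:R *: (GD_gen p n k).1, false)%R.
Proof.
elim: m => [|m IH]; first by rewrite scale0r.
rewrite expgS IH; congr (_, _).
by rewrite /= expr0 scale1r -natr1 scalerDl scale1r addrC.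
Qed.

Fact GD_genXF n k (i : 'F_p) :
  GD_gen p n k ^+ i = (i *: (GD_gen p n k).1, false)%R.
Proof. by rewrite GD_genX natr_Zp. Qed.

Fact GD2_elt (x : GD p 2) :
  x = GD_gen p 2 0 ^+ x.1 ord0 ord0 * GD_gen p 2 1 ^+ x.1 ord0 ord_max
      * GD_h p 2 ^+ x.2.
Proof.
case: x => u s; rewrite !GD_genXF /=.
have -> : GD_h p 2 ^+ s = (0%R, s) by case: s.
congr (_, _) => //=; rewrite !expr0 !scale1r addr0.
apply/rowP=> j; rewrite !mxE.
case: (unliftP ord0 j) => [j' ->|->] /=; rewrite ?ord1 /=.
  by rewrite mulr0 add0r mulr1; congr (u _ _); apply/val_inj.
by rewrite mulr1 mulr0 addr0.
Qed.

Let mem_cycles (gT : finGroupType) (a d h : gT) i j k :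
  a ^+ i * d ^+ j * h ^+ k \in <[a]> <*> <[d]> <*> <[h]>.
Proof.
rewrite groupM //; last by rewrite mem_gen // inE mem_cycle orbT.
by rewrite mem_gen // inE groupM // mem_gen // inE mem_cycle ?orbT.
Qed.

Fact GD2_presentation :
  [set: GD p 2] \isog
    Grp (a : d : h : a ^+ p, d ^+ p, h ^+ 2, [~ a, d],
                     h^-1 * a * h = a^-1, h^-1 * d * h = d^-1).
Proof.
apply: intro_isoGrp => [|rT H].
  have introG (gT : finGroupType) (a d h : gT) :
      <[a]> <*> <[d]> <*> <[h]> = [set: gT] ->
      a ^+ p = 1 -> d ^+ p = 1 -> h ^+ 2 = 1 -> [~ a, d] = 1 ->
      h^-1 * a * h = a^-1 -> h^-1 * d * h = d^-1 ->
      [set: gT] \homg Grp (a : d : h : a ^+ p, d ^+ p, h ^+ 2, [~ a, d],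
                            h^-1 * a * h = a^-1, h^-1 * d * h = d^-1).
    move=> genG ap dp h2 cad ah dh; apply/existsP; exists (a, d, h).
    by rewrite /= genG ap dp h2 cad ah dh.
  have genp k : GD_gen p 2 k ^+ p = 1.
    by rewrite GD_genX pchar_Fp_0 // scale0r.
  have hV : (GD_h p 2)^-1 = GD_h p 2.
    by congr (_, _); rewrite /= scaler0 oppr0.
  have h2 : GD_h p 2 ^+ 2 = 1 by rewrite expg2 -{1}hV mulVg.
  have genh k : (GD_h p 2)^-1 * GD_gen p 2 k * GD_h p 2 = (GD_gen p 2 k)^-1.
    rewrite hV; congr (_, _).
    by rewrite /= expr0 scale1r scaler0 addr0 add0r expr1 scaleN1r.
  have commD : [~ GD_gen p 2 0, GD_gen p 2 1] = 1.
    have cad : commute (GD_gen p 2 0) (GD_gen p 2 1).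
      rewrite /commute !GD_mulE /GD_mul /= !expr0 !scale1r.
      by rewrite [X in (X, _) = _]addrC.
    exact/eqP/(introT commgP cad).
  apply: (introG _ _ _ _ _ (genp 0%N) (genp 1%N) h2 commD (genh _) (genh _)).
  apply/eqP; rewrite eqEsubset subsetT; apply/subsetP=> x _; rewrite [x]GD2_elt.
  exact: mem_cycles.
case/existsP=> -[[a d] h] /= /eqP[defH ap dp h2 cad ah dh].
have{} ah : a ^ h = a^-1 by rewrite conjgE mulgA.
have{} dh : d ^ h = d^-1 by rewrite conjgE mulgA.
have{} cad : commute a d by apply/commgP/eqP.
pose t (u : 'rV['F_p]_2) := a ^+ u ord0 ord0 * d ^+ u ord0 ord_max.
have expD (x : rT) (xp : x ^+ p = 1) (i j : 'F_p) :
    x ^+ (i + j)%R = x ^+ i * x ^+ j.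
  by rewrite -expgnDr /= expg_mod // Fp_p.
have tD u v : t (u + v)%R = t u * t v.
  rewrite /t !mxE !expD // !mulgA; congr (_ * _).
  rewrite -!mulgA; congr (_ * _).
  exact/commuteX2.
have t0 : t 0%R = 1 by rewrite /t !mxE !expg0 mulg1.
have tN u : t (- u)%R = (t u)^-1.
  by apply/eqP; rewrite eq_sym eq_invg_mul -tD addrN t0.
have tJ u : t u ^ h = (t u)^-1.
  rewrite /t conjMg !conjXg ah dh !expgVn -invMg; congr (_^-1).
  exact/commuteX2/commute_sym.
pose f (x : GD p 2) := t x.1 * h ^+ x.2.
have fM : {in [set: GD p 2] &, {morph f : x y / x * y}}.
  case=> u s [v r] _ _; rewrite /f /= tD.
  have hh : h * h = 1 by rewrite -expg2.
  have hV : h^-1 = h by apply/eqP; rewrite eq_invg_mul hh.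
  have th w : h * t w = (t w)^-1 * h.
    by rewrite -tJ conjgE hV -!mulgA hh mulg1.
  rewrite -[LHS]mulgA -[RHS]mulgA; apply: (congr1 (fun z => t u * z)).
  rewrite [RHS]mulgA.
  case: s r => -[]; rewrite /= ?expr0 ?expr1 ?scale1r ?scaleN1r ?expg1 ?expg0.
  - by rewrite tN th -mulgA hh.
  - by rewrite tN th !mulg1.
  - by rewrite mul1g.
  by rewrite mul1g.
apply/homgP; exists (Morphism fM); rewrite -defH /=.
have Hf x : f x \in <[a]> <*> <[d]> <*> <[h]>.
  exact: mem_cycles.
apply/eqP; rewrite eqEsubset; apply/andP; split.
  by apply/subsetP=> _ /morphimP[x _ _ ->]; apply: Hf.
rewrite !join_subG !cycle_subG; apply/andP; split; [apply/andP; split|].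
- apply/morphimP; exists (GD_gen p 2 0); rewrite ?inE //=.
  by rewrite /f /t !mxE /= expg0 expg1 !mulg1.
- apply/morphimP; exists (GD_gen p 2 1); rewrite ?inE //=.
  by rewrite /f /t !mxE /= expg0 expg1 mulg1 mul1g.
apply/morphimP; exists (GD_h p 2); rewrite ?inE //=.
by rewrite /f /= t0 mul1g.
Qed.

End Presentation.

(* Since GD_gen p n k ^+ p = 1, an exponent in 'F_p is read through its       *)
(* representative in nat.                                                    *)
Section ConnectionSets.

Variable p : nat.
Implicit Types l lambda : 'F_p.

Definition CGD1_set l : {set GD p 2} :=
  let a := GD_gen p 2 0 in let d := GD_gen p 2 1 in let h := GD_h p 2 in
  [set h; a * h;
       a ^+ (l * (l + 1)^-1)%R * d ^+ (l^-1)%R * h;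
       a ^+ l * d ^+ ((l + 1)^-1)%R * h;
       d * h].

Definition CGD2_set lambda : {set GD p 2} :=
  let a := GD_gen p 2 0 in let d := GD_gen p 2 1 in let h := GD_h p 2 in
  [set h; a * h;
       a ^+ (2%:R^-1 * (1 + lambda))%R * d * h;
       a * d ^+ (2%:R^-1 * (1 + lambda))%R * h;
       d * h].

Definition CGD3_set l : {set GD p 3} :=
  let a := GD_gen p 3 0 in let b := GD_gen p 3 1 in let d := GD_gen p 3 2 in
  let h := GD_h p 3 in
  [set h; a * h; b * h;
       a ^+ (- l ^+ 2)%R * b ^+ (- l)%R * d ^+ (- l^-1)%R * h;
       d * h].

Definition CGD4_set : {set GD p 4} :=
  let a := GD_gen p 4 0 in let b := GD_gen p 4 1 in
  let c := GD_gen p 4 2 in let d := GD_gen p 4 3 in let h := GD_h p 4 in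
  [set h; a * h; b * h; c * h; d * h].

Fact GD_conn_set n (S : {set GD p n}) :
  (forall x, x \in S -> x.2) -> (1 \notin S) /\ S^-1 = S.
Proof.
move=> S2; split; first by apply/negP=> /S2.
have SV x : x \in S -> x^-1 = x.
  move=> /S2; case: x => u [] // _.
  by congr (_, _); rewrite /= expr1 scaleN1r opprK.
apply/setP=> x; rewrite inE; apply/idP/idP=> Sx; last by rewrite SV.
by rewrite -[x]invgK SV.
Qed.

Let X2 n k m : (GD_gen p n k ^+ m).2 = false.
Proof. by rewrite GD_genX. Qed.

Fact CGD1_set_conn l : 1 \notin CGD1_set l /\ (CGD1_set l)^-1 = CGD1_set l.
Proof.
apply: GD_conn_set => x; rewrite !inE -!orbA.
by do 4?[case/predU1P=> [->|]]; last move/eqP->; rewrite ?GD_mulE /= ?X2.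
Qed.

Fact CGD2_set_conn l : 1 \notin CGD2_set l /\ (CGD2_set l)^-1 = CGD2_set l.
Proof.
apply: GD_conn_set => x; rewrite !inE -!orbA.
by do 4?[case/predU1P=> [->|]]; last move/eqP->; rewrite ?GD_mulE /= ?X2.
Qed.

Fact CGD3_set_conn l : 1 \notin CGD3_set l /\ (CGD3_set l)^-1 = CGD3_set l.
Proof.
apply: GD_conn_set => x; rewrite !inE -!orbA.
by do 4?[case/predU1P=> [->|]]; last move/eqP->; rewrite ?GD_mulE /= ?X2.
Qed.

Fact CGD4_set_conn : 1 \notin CGD4_set /\ CGD4_set^-1 = CGD4_set.
Proof.
apply: GD_conn_set => x; rewrite !inE -!orbA.
by do 4?[case/predU1P=> [->|]]; last move/eqP->; rewrite ?GD_mulE /= ?X2.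
Qed.

Definition ell_spec (l : {unit 'F_p}) : Prop :=
  (p = 5 /\ l = 1) \/ (5 %| p.-1 /\ #[l] = 5)%N.

End ConnectionSets.

Section Graphs.

Variable T : finType.
Implicit Types (e : rel T) (H : {set {perm T}}).

Definition graph_aut e : {set {perm T}} :=
  [set f : {perm T} | [forall x, forall y, e (f x) (f y) == e x y]].

Fact graph_aut_group_set e : group_set (graph_aut e).
Proof.
apply/group_setP; split=> [|f g]; rewrite !inE.
  by apply/forallP=> x; apply/forallP=> y; rewrite !perm1.
move=> /forallP ef /forallP eg; apply/forallP=> x; apply/forallP=> y.
by rewrite !permM (eqP (forallP (eg _) _)) (eqP (forallP (ef _) _)).
Qed.

Canonical graph_aut_group e := Group (graph_aut_group_set e).

Definition arc_transitive e H : Prop :=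
  H \subset graph_aut e /\
  forall x y u v, e x y -> e u v -> exists2 f, f \in H & (f x, f y) = (u, v).

End Graphs.

Section Cayley.

Variable gT : finGroupType.

(* The edges are the {g, s * g} for s in S. The relation is symmetric and    *)
(* irreflexive when S^-1 = S and 1 \notin S, as for the CGDi_set above.       *)
Definition Cay (S : {set gT}) : rel gT := fun x y => y * x^-1 \in S.

(* 'R is the action by right translations, R(g) : x |-> x * g.               *)
Definition right_regular : {group {perm gT}} := (actperm 'R @* [set: gT])%G.

End Cayley.

(* Main.v *)
Require Import Defs.
From mathcomp Require Import all_boot all_order all_algebra all_fingroup.
From mathcomp Require Import all_solvable.
From mathcomp Require Import ring.

(* The group N_A(R(G)) is R(G) extended by Aut(G, S). Sending x to its        *)
(* position in the nontrivial coset of F_p^n turns S into five points that    *)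
(* span affine space, and (for p odd) Aut(G, S) into the permutations of      *)
(* these points that extend to affine maps. In every case the cyclic rotation *)
(* h -> ah -> ... -> dh -> h does, so Aut(G, S) is transitive on S; as P is   *)
(* characteristic in R(G), this already gives arc-transitivity under N_A(P).  *)
(* The affine permutations are then found by linear algebra. Finally |N_A(P)| *)
(* <> 20 p^2, because for 5 | p - 1 it would make N_A(R(G)) of index 2 in     *)
(* N_A(P), so that its normal Hall subgroup R(G) would be normal in N_A(P),   *)
(* and for p = 5 the order of N_A(R(G)) is too large.                         *)

Set Implicit Arguments.
Unset Strict Implicit.
Unset Printing Implicit Defensive.

Import GRing.Theory.
Local Open Scope group_scope.

(** Which permutations of the five points are affine depends on the affine relations between the
    points. In $\mathbb{Z}_p^4$ there is none, so all of $S_5$ extends. In $\mathbb{Z}_p^3$ there is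
    one, with coefficients $\ell^{3-i}$: the rotation multiplies it by a power of $\ell$, and for
    $\ell=1$ every permutation preserves it. In the plane, $\mathcal{CGD}^2$ is an affinely regular
    pentagon, with dihedral symmetry. $\mathcal{CGD}^1$ is affinely equivalent to the points
    $(\ell^{3i},\ell^i)$ for $5\mid p-1$, where only the rotations are affine, and to the points
    $(i,i^2)$ of a parabola for $p=5$, where all $i\mapsto ai+b$ are affine.

    The structure of $N_A(R(G))$ is [sdprod_right_regular]; [mem_affine_sym] and [affine_symP]
    translate between $\mathrm{Aut}(G,S)$ and affine permutations. The upper bounds in the plane
    come from [CGD1_fix0], [CGD1_five_fix01] and [CGD2_fix0], which control the stabilizer of the
    point 0. The passage to $N_A(P)$ is [sub_norm_sylow] and [card_norm_sylow_neq]. *)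

Section CayleyNormalizer.

(** * The normalizer of the right regular representation *)

Variables (gT : finGroupType) (S : {set gT}).

Let A := graph_aut_group (Cay S).
Let R := right_regular gT.

(** This is $\mathrm{Aut}(G,S)$, the group automorphisms that stabilize [S] setwise. *)
Definition conn_aut : {group {perm gT}} := 'N_(Aut [set: gT])(S | 'P)%G.

Lemma right_regularP (f : {perm gT}) :
  reflect (exists g, forall x, f x = x * g) (f \in R).
Proof.
apply: (iffP idP) => [/morphimP[g _ _ ->]|[g fE]].
  by exists g => x; rewrite actpermE.
have -> : f = actperm 'R g by apply/permP=> x; rewrite fE actpermE.
by apply: mem_morphim; rewrite inE.
Qed.

Lemma conn_autP (f : {perm gT}) :
  reflect ({morph f : x y / x * y} /\ forall x, (f x \in S) = (x \in S))
          (f \in conn_aut).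
Proof.
apply: (iffP setIP) => [[fA fS]|[fM fS]]; split.
- move: fA; rewrite inE => /andP[_ /morphicP fM] x y.
  by apply: fM; rewrite inE.
- by move=> x; apply: (astabs_act x fS).
- rewrite inE; apply/andP; split.
    by apply/subsetP=> x _; rewrite inE.
  by apply/morphicP=> x y _ _; apply: fM.
by rewrite !inE; apply/subsetP=> x xS; rewrite inE /= apermE fS.
Qed.

Lemma graph_autP (f : {perm gT}) :
  reflect (forall x y, Cay S (f x) (f y) = Cay S x y) (f \in A).
Proof.
rewrite inE; apply: (iffP forallP) => fE x.
  by move=> y; apply/eqP; apply: (forallP (fE x)).
by apply/forallP=> y; rewrite fE.
Qed.

Lemma right_regular_sub_aut : R \subset A.
Proof.
apply/subsetP=> f /right_regularP[g fE]; apply/graph_autP=> x y.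
by rewrite /Cay !fE invMg mulgA mulgK.
Qed.

Lemma conn_aut1 f : f \in conn_aut -> f 1 = 1.
Proof.
by case/conn_autP=> fM _; apply: (mulgI (f 1)); rewrite -fM !mulg1.
Qed.

Lemma conn_aut_sub_aut : conn_aut \subset A.
Proof.
apply/subsetP=> f fK; have /conn_autP[fM fS] := fK.
have fV x : f x^-1 = (f x)^-1.
  by apply: (mulgI (f x)); rewrite -fM !mulgV conn_aut1.
by apply/graph_autP=> x y; rewrite /Cay -fV -fM fS.
Qed.

Lemma conn_aut_norm : conn_aut \subset 'N(R).
Proof.
apply/subsetP=> f fK; have /conn_autP[fM _] := fK.
rewrite inE; apply/subsetP=> _ /imsetP[r /right_regularP[g rE] ->].
apply/right_regularP; exists (f g) => x.
by rewrite conjgE !permM rE fM permKV.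
Qed.

(** A translation brings the image of 1 back to 1. An element of the normalizer that fixes 1
    conjugates translations to translations, hence is multiplicative, and it preserves the
    neighbourhood [S] of 1. *)
Lemma sdprod_right_regular : R ><| conn_aut = 'N_A(R).
Proof.
rewrite sdprodE; first 1 last.
- exact: conn_aut_norm.
- apply/trivgP/subsetP=> f /setIP[/right_regularP[g fE] /conn_aut1 f1].
  apply/set1P/permP=> x; move: f1; rewrite fE mul1g => g1.
  by rewrite fE g1 mulg1 perm1.
apply/eqP; rewrite eqEsubset; apply/andP; split.
  rewrite mul_subG //= subsetI ?right_regular_sub_aut ?normG //.
  by rewrite conn_aut_sub_aut conn_aut_norm.
apply/subsetP=> f /setIP[fA fN].
pose r := actperm 'R (f 1).
have rR : r \in R by apply: mem_morphim; rewrite inE.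
pose k := f * r^-1.
have kA : k \in A by rewrite groupM // groupV (subsetP right_regular_sub_aut).
have kN : k \in 'N(R) by rewrite groupM // groupV (subsetP (normG _)).
have k1 : k 1 = 1.
  by apply: (@perm_inj _ r); rewrite permM permKV actpermE /= mul1g.
have -> : f = k * r by rewrite mulgKV.
clearbody k; have kM : {morph k : x y / x * y}.
  move=> x g; have sR : actperm 'R g \in R by apply: mem_morphim; rewrite inE.
  have : actperm 'R g ^ k \in R by rewrite memJ_norm.
  case/right_regularP=> g' gE.
  have kE y : k (y * g) = k y * g'.
    by rewrite -gE conjgE !permM permK actpermE.
  by rewrite kE -[g in RHS]mul1g kE k1 mul1g.
have kS x : (k x \in S) = (x \in S).
  by have /graph_autP/(_ 1 x) := kA; rewrite /Cay k1 invg1 !mulg1.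
have kK : k \in conn_aut by apply/conn_autP.
by rewrite -(normC conn_aut_norm) mem_mulg.
Qed.

Lemma right_regular_card : #|R| = #|gT|.
Proof.
rewrite card_injm ?cardsT //; apply/injmP=> g g' _ _ /permP/(_ 1).
by rewrite !actpermE /= !mul1g.
Qed.

(** An arc $(x,y)$ is translated to $(1,yx^{-1})$; an automorphism then moves its end within [S] and
    fixes 1, and a second translation reaches $(u,v)$. *)
Lemma Cay_arc_transitive (H : {group {perm gT}}) :
    H \subset A -> R \subset H ->
    {in S &, forall s t, exists2 f, f \in H :&: conn_aut & f s = t} ->
  arc_transitive (Cay S) H.
Proof.
move=> HA RH trS; split=> // x y u v xy uv.
have [f /setIP[fH fK] fE] := trS _ _ xy uv.
have /conn_autP[fM _] := fK.
have tH g : actperm 'R g \in H.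
  by apply: (subsetP RH); apply: mem_morphim; rewrite inE.
exists (actperm 'R x^-1 * f * actperm 'R u); first by rewrite !groupM.
by rewrite !permM !actpermE /= mulgV conn_aut1 // mul1g fE mulgKV.
Qed.

End CayleyNormalizer.

(** * The action of Aut(G, S) on an indexed connection set *)

Section ConnectionPerm.

Variables (gT : finGroupType) (T : finType) (s : T -> gT).
Hypothesis s_inj : injective s.

Let S := [set s i | i : T].
Let K := conn_aut S.

(** The default 1 is returned only if no permutation of the indices describes [f] on the points; by
    [conn_permE] this does not occur on [K]. *)
Definition conn_perm (f : {perm gT}) : {perm T} :=
  odflt 1 [pick u : {perm T} | [forall i, f (s i) == s (u i)]].

Lemma conn_permE f i : f \in K -> f (s i) = s (conn_perm f i).
Proof.
case/conn_autP=> _ fS; rewrite /conn_perm.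
case: pickP => [u /forallP/(_ i)/eqP //|no_u].
have fs j : {k | f (s j) = s k}.
  have /imsetP/sig2_eqW[k _ ->] : f (s j) \in S by rewrite fS imset_f.
  by exists k.
have sf_inj : injective (fun j => sval (fs j)).
  move=> j k; case: (fs j) (fs k) => j' jE [k' kE] /= eqjk.
  by apply/s_inj/(@perm_inj _ f); rewrite jE kE eqjk.
have /negP[] := no_u (perm sf_inj).
by apply/forallP=> j; rewrite permE; case: (fs j) => k /= ->.
Qed.

Lemma conn_permM : {in K &, {morph conn_perm : f g / f * g}}.
Proof.
move=> f g fK gK; apply/permP=> i; apply: s_inj.
by rewrite -conn_permE ?groupM // !permM !conn_permE.
Qed.

Canonical conn_perm_morphism := Morphism conn_permM.

Definition conn_sym : {group {perm T}} := (conn_perm @* K)%G.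

Lemma mem_conn_sym f (u : {perm T}) :
  f \in K -> (forall i, f (s i) = s (u i)) -> u \in conn_sym.
Proof.
move=> fK fE; have -> : u = conn_perm f.
  by apply/permP=> i; apply: s_inj; rewrite -fE conn_permE.
exact: mem_morphim.
Qed.

(** The fixed points of an automorphism form a subgroup; in the kernel this subgroup contains
    [S]. *)
Lemma injm_conn_perm : <<S>> = [set: gT] -> 'injm conn_perm.
Proof.
move=> genS; apply/subsetP=> f /morphpreP[fK /set1P rf1].
have /conn_autP[fM _] := fK.
have fixgrp : group_set [set x | f x == x].
  apply/group_setP; split=> [|x y]; rewrite !inE; first by rewrite (conn_aut1 fK).
  by rewrite fM => /eqP-> /eqP->.
have : <<S>> \subset Group fixgrp.
  rewrite gen_subG; apply/subsetP=> _ /imsetP[i _ ->].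
  by rewrite inE conn_permE // rf1 perm1.
rewrite genS => /subsetP fix_all.
apply/set1P/permP=> x; have := fix_all x; rewrite !inE => /(_ isT)/eqP->.
by rewrite perm1.
Qed.

Lemma conn_sym_isog : <<S>> = [set: gT] -> K \isog conn_sym.
Proof. by move/injm_conn_perm=> inj; apply: sub_isog. Qed.

Lemma conn_sym_trans (H : {group {perm gT}}) :
    H \subset graph_aut (Cay S) -> right_regular gT \subset H -> K \subset H ->
    (forall i j, exists2 u, u \in conn_sym & u i = j) ->
  arc_transitive (Cay S) H.
Proof.
move=> HA RH KH trK; apply: Cay_arc_transitive => //.
move=> _ _ /imsetP[i _ ->] /imsetP[j _ ->].
have [_ /morphimP[f _ fK ->] fij] := trK i j.
exists f; first by rewrite inE (subsetP KH).
by rewrite conn_permE // fij.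
Qed.

End ConnectionPerm.

(** * Automorphisms of the generalized dihedral group *)

Section GDAut.

Variables (p n : nat).
Hypothesis p_pr : prime p.
Local Open Scope ring_scope.
Local Notation V := 'rV['F_p]_n.

Local Notation gd u b := ((u, b) : GD p n).

Lemma GD_mul0 (u w : V) b : (gd u false * gd w b)%g = gd (u + w) b.
Proof. by rewrite GD_mulE /GD_mul /= expr0 scale1r. Qed.

Lemma GD_mul1 (u w : V) b : (gd u true * gd w b)%g = gd (u - w) (~~ b).
Proof. by rewrite GD_mulE /GD_mul /= expr1 scaleN1r. Qed.

Lemma GD_exp (u : V) m : (gd u false ^+ m)%g = gd (m%:R *: u) false.
Proof.
elim: m => [|m IH]; first by rewrite scale0r.
by rewrite expgS IH GD_mul0 -nat1r scalerDl scale1r.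
Qed.

Lemma GD_card : #|{: GD p n}| = (2 * p ^ n)%N.
Proof.
by rewrite card_prod card_bool card_mx card_Fp // mul1n mulnC.
Qed.

(** The homomorphism that is linear on the translation subgroup and sends $h$ to $ch$; on the
    nontrivial coset it is the affine map $u\mapsto uL+c$. *)
Definition GD_affine (L : 'M['F_p]_n) (c : V) (x : GD p n) : GD p n :=
  (x.1 *m L + x.2%:R *: c, x.2).

Lemma GD_affineM L c : {morph GD_affine L c : x y / (x * y)%g}.
Proof.
case=> u b [w d]; rewrite /GD_affine.
case: b; rewrite ?GD_mul1 ?GD_mul0 /= ?mulmxDl ?mulNmx ?scale0r ?scale1r.
  congr (_, _); rewrite opprD addrACA; congr (_ + _).
  by case: d; rewrite /= ?scale0r ?scale1r ?subrr ?subr0 ?addr0.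
by rewrite addr0 addrA.
Qed.

Lemma GD_affine_inj L c : L \in unitmx -> injective (GD_affine L c).
Proof.
move=> uL [u b] [w d] [E eqbd]; rewrite {}eqbd in E *.
by move/addIr/(can_inj (mulmxK uL)): E => ->.
Qed.

End GDAut.

(** * Aut(G, S) as a group of affine permutations *)

Section PointConfiguration.

Variables (p n : nat).
Hypothesis p_pr : prime p.
Local Open Scope ring_scope.
Local Notation V := 'rV['F_p]_n.
Local Notation gd u b := ((u, b) : GD p n).

Variables (T : finType) (v : T -> V) (t0 : T) (b : 'I_n -> T).
Hypotheses (v_inj : injective v) (v0 : v t0 = 0).
Hypothesis v_basis : forall k, v (b k) = delta_mx 0 k.

Definition GD_point i := gd (v i) true.
Local Notation S := [set GD_point i | i : T].

Lemma GD_point_inj : injective GD_point.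
Proof. by move=> i j [/v_inj]. Qed.

Definition affine_sym : {group {perm T}} := conn_sym GD_point_inj.
Local Notation Q := affine_sym.

Lemma GD_point_gen : <<S>>%g = [set: GD p n].
Proof.
apply/eqP; rewrite eqEsubset subsetT; apply/subsetP=> -[w c] _.
have S_mem i : GD_point i \in <<S>>%g by rewrite mem_gen ?imset_f.
have h_mem : gd 0 true \in <<S>>%g by rewrite -v0 S_mem.
have e_mem k a : gd (a *: delta_mx 0 k) false \in <<S>>%g.
  have -> : gd (a *: delta_mx 0 k) false = (gd (delta_mx 0 k) false ^+ a)%g.
    by rewrite GD_exp natr_Zp.
  rewrite groupX //; have := groupM (S_mem (b k)) h_mem.
  by rewrite GD_mul1 subr0 v_basis.
have V_mem : gd w false \in <<S>>%g.
  rewrite [w]row_sum_delta; apply: (big_ind (fun w => gd w false \in <<S>>%g)) => //.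
    exact: group1.
  by move=> x y xS yS; rewrite -GD_mul0 groupM.
case: c => //; have := groupM V_mem h_mem.
by rewrite GD_mul0 addr0.
Qed.

Lemma mem_affine_sym (u : {perm T}) (L : 'M['F_p]_n) (c : V) :
  (forall i, v (u i) = v i *m L + c) -> u \in Q.
Proof.
move=> vE.
(* Each basis vector is a difference of two points, and since [u] is onto, this is [L] applied to
   the difference of their preimages; so the row space of [L] is full. *)
have uL : L \in unitmx.
  rewrite -row_full_unit -sub1mx; apply/row_subP=> k; rewrite row1.
  rewrite -v_basis -[v _]subr0 -v0.
  rewrite -(permKV u (b k)) -(permKV u t0) !vE.
  by rewrite opprD addrACA subrr addr0 -mulmxBl submxMl.
pose f := perm (GD_affine_inj (c := c) uL).
have fE i : f (GD_point i) = GD_point (u i).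
  by rewrite permE /GD_affine /GD_point /= scale1r vE.
apply: (@mem_conn_sym _ _ _ GD_point_inj f) => [|i]; last exact: fE.
apply/conn_autP; split=> [x y|x]; first by rewrite !permE GD_affineM.
apply/imsetP/imsetP=> -[i _].
  rewrite -(permKV u i) -fE => /perm_inj ->; by exists (u^-1 i)%g.
by move->; exists (u i).
Qed.

Lemma affine_symP (u : {perm T}) : odd p -> u \in Q ->
  exists L : 'M['F_p]_n, exists c : V, forall i, v (u i) = v i *m L + c.
Proof.
move=> p_odd /morphimP[f _ fK ->{u}].
have /conn_autP[fM _] := fK.
have two_neq0 : 2%:R != 0 :> 'F_p.
  rewrite -(dvdn_pcharf (pchar_Fp p_pr)) dvdn_prime2 //.
  by apply: contraL p_odd => /eqP->.
pose g (w : V) := (f (gd w false)).1.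
(* Every element of the nontrivial coset squares to 1, so a translation sent there by [f] would
   satisfy $2w=0$; as [p] is odd, $w=0$, which is impossible because [f] fixes the identity. *)
have fE w : f (gd w false) = gd (g w) false.
  rewrite /g; case fw : (f (gd w false)) => [x [|]] //=.
  have : f (gd w false * gd w false)%g = 1%g by rewrite fM fw GD_mul1 subrr.
  rewrite GD_mul0 -(conn_aut1 fK) => /perm_inj[/eqP].
  rewrite -mulr2n -scaler_nat scaler_eq0 (negPf two_neq0) /= => /eqP w0.
  by move: fw; rewrite w0 (conn_aut1 fK) => -[].
have gD w x : g (w + x) = g w + g x.
  have: f (gd (w + x) false) = gd (g w + g x) false.
    by rewrite -!GD_mul0 fM !fE.
  by rewrite fE => -[].
(* Scaling over the prime field is iterated addition, so additivity already gives linearity. *)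
have gZ (a : 'F_p) w : g (a *: w) = a *: g w.
  rewrite -(natr_Zp a); elim: (a : nat) => [|m IH].
    by apply: (addIr (g 0)); rewrite !scale0r -gD !add0r.
  by rewrite -nat1r !scalerDl !scale1r gD IH.
have gL w : g w = w *m (\matrix_k g (delta_mx 0 k)).
  rewrite mulmx_sum_row {1}[w]row_sum_delta.
  elim/big_rec2: _ => [|k y x _ <-].
    by apply: (addIr (g 0)); rewrite -gD !add0r.
  by rewrite gD gZ rowK.
exists (\matrix_k g (delta_mx 0 k)), (v (conn_perm GD_point f t0)) => i.
rewrite -gL.
have : GD_point (conn_perm GD_point f i) = gd (g (v i) + v (conn_perm GD_point f t0)) true.
  rewrite -conn_permE //; last exact: GD_point_inj.
  have -> : GD_point i = (gd (v i) false * GD_point t0)%g.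
    by rewrite GD_mul0 v0 addr0.
  by rewrite fM fE conn_permE ?GD_mul0 //; apply: GD_point_inj.
by case.
Qed.

Lemma GD_conn_isog : conn_aut S \isog Q.
Proof. exact: conn_sym_isog GD_point_gen. Qed.



End PointConfiguration.

(** * From the normalizer of R(G) to the normalizer of P *)

Section SylowNormalizer.

Variables (p n : nat).
Hypothesis p_pr : prime p.
Variable (S : {set GD p n}) (P : {group {perm GD p n}}).

Let R := right_regular (GD p n).
Let A := graph_aut_group (Cay S).
Let K := conn_aut S.

Hypothesis sylP : P \in 'Syl_p(R).

Lemma right_regular_GD_card : #|R| = (2 * p ^ n)%N.
Proof. by rewrite right_regular_card GD_card. Qed.

(** A normal Sylow subgroup is characteristic. For $p=2$, [R] is a 2-group and equals [P]; for odd
    [p], [P] has index 2. *)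
Lemma sylow_right_regular_char : P \char R.
Proof.
have hallP : p.-Sylow(R) P by move: sylP; rewrite inE.
have sPR := pHall_sub hallP.
suff nPR : P <| R by rewrite -(normal_Hall_pcore hallP nPR) pcore_char.
have [p2|p_odd] := even_prime p_pr.
  have pR : p.-group R.
    by rewrite /pgroup right_regular_GD_card pnatM pnatX pnat_id // p2.
  by rewrite /normal (pHall_id hallP pR) normG subxx.
apply: index2_normal => //; apply/eqP.
have oP : #|P| = (p ^ n)%N.
  rewrite (card_Hall hallP) right_regular_GD_card partnM ?expn_gt0 ?prime_gt0 //.
  rewrite [X in (X * _)%N]part_p'nat ?mul1n ?part_pnat_id ?pnatX ?pnat_id //.
  rewrite p'natE // dvdn_prime2 //.
  by apply: contraL p_odd => /eqP->.
by rewrite -divgS // oP right_regular_GD_card mulnK ?expn_gt0 ?prime_gt0.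
Qed.

Lemma sub_norm_sylow : 'N_A(R) \subset 'N_A(P).
Proof. by rewrite setIS // char_norms // sylow_right_regular_char. Qed.

Lemma right_regular_norm_sylow : R \subset 'N_A(P).
Proof.
by apply: subset_trans sub_norm_sylow; rewrite subsetI right_regular_sub_aut normG.
Qed.

Lemma conn_aut_norm_sylow : K \subset 'N_A(P).
Proof.
apply: subset_trans sub_norm_sylow.
by rewrite subsetI conn_aut_sub_aut conn_aut_norm.
Qed.

Lemma card_norm_right_regular : #|'N_A(R)| = (2 * p ^ n * #|K|)%N.
Proof. by rewrite -(sdprod_card (sdprod_right_regular S)) right_regular_GD_card. Qed.

(* If the index of 'N_A(R) in 'N_A(P) is at most 2, then 'N_A(R) is normal in *)
(* 'N_A(P), and so is its characteristic Hall subgroup R.                     *)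
Lemma card_norm_sylow_neq :
  #|K| = 5 -> ~~ (5 %| 2 * p)%N -> #|'N_A(P)| <> (20 * p ^ n)%N.
Proof.
move=> oK p5 oN.
have pn0 : (0 < p ^ n)%N by rewrite expn_gt0 prime_gt0.
have oNR := card_norm_right_regular; rewrite oK in oNR.
have nNR : 'N_A(R) <| 'N_A(P).
  apply: index2_normal; first exact: sub_norm_sylow.
  apply/eqP; rewrite -divgS ?sub_norm_sylow //= oN oNR.
  have -> : (20 * p ^ n = 2 * (2 * p ^ n * 5))%N by ring.
  by rewrite mulnK // !muln_gt0 pn0.
have hallR : Hall 'N_A(R) R.
  have sRN : R \subset 'N_A(R) by rewrite subsetI right_regular_sub_aut normG.
  rewrite /Hall sRN -divgS //= oNR right_regular_GD_card mulKn ?muln_gt0 ?pn0 //.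
  rewrite coprime_sym prime_coprime //.
  by apply: contra p5; rewrite !Euclid_dvdM // Euclid_dvdX // => /andP[].
have nRN : R <| 'N_A(R).
  by rewrite /normal subsetI right_regular_sub_aut normG subsetIr.
have charR : R \char 'N_A(R).
  have /Hall_pi hallpi := hallR.
  by have := pcore_char \pi(R) 'N_A(R); rewrite (normal_Hall_pcore hallpi nRN).
have /normal_norm nRP := char_normal_trans charR nNR.
(* This inclusion would give $20p^n\le 10p^n$. *)
have : 'N_A(P) \subset 'N_A(R) by rewrite subsetI subsetIl.
move/subset_leq_card; rewrite oN oNR.
by rewrite mulnAC leq_pmul2r.
Qed.

End SylowNormalizer.

(** * Subgroups of S_5 containing the rotation of Z/5 *)

Section FivePoints.

Local Open Scope ring_scope.

Lemma natr_ord5 (i : 'I_5) : (i : nat)%:R = i :> 'I_5.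
Proof. by case: i => -[|[|[|[|[|//]]]]] i; apply: val_inj. Qed.

Definition rot5 : 'S_5 := perm (@addIr 'I_5 1).
Lemma rot5E i : rot5 i = i + 1. Proof. exact: permE. Qed.
Lemma rot5X k i : (rot5 ^+ k)%g i = i + k%:R.
Proof.
elim: k => [|k IH]; first by rewrite perm1 addr0.
by rewrite expgSr permM IH rot5E -natr1 addrA.
Qed.

Definition flip5 : 'S_5 := perm (@oppr_inj 'I_5).
Lemma flip5E i : flip5 i = - i. Proof. exact: permE. Qed.

Lemma dbl5_inj : injective (fun i : 'I_5 => i *+ 2).
Proof.
by apply: (can_inj (g := fun i => i *+ 3)) => -[[|[|[|[|[|//]]]]] i]; apply/val_inj.
Qed.
Definition dbl5 : 'S_5 := perm dbl5_inj.
Lemma dbl5E i : dbl5 i = i *+ 2. Proof. exact: permE. Qed.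

Lemma rot5_order : #[rot5]%g = 5%N.
Proof.
apply: nt_prime_order => //.
  apply/permP=> i; rewrite rot5X perm1 (_ : 5%:R = 0 :> 'I_5) ?addr0 //.
  exact/eqP.
by apply/eqP=> /permP/(_ 0); rewrite rot5E perm1.
Qed.

Variable G : {group 'S_5}.
Hypothesis rotG : rot5 \in G.

Lemma rot5_trans i j : exists2 u, u \in G & u i = j.
Proof.
exists (rot5 ^+ (j - i)%R)%g; first exact: groupX.
by rewrite rot5X natr_ord5 addrC subrK.
Qed.

Lemma dvdn5_card : (5 %| #|G|)%N.
Proof. by have := order_dvdG rotG; rewrite rot5_order. Qed.

(** An element of [G] is determined by its image of 0, so the order is at most 5, while the rotation
    makes it a multiple of 5. *)
Lemma rot5_isog : (forall u : 'S_5, u \in G -> u 0 = 0 -> u = 1%g) -> G \isog Zp 5.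
Proof.
move=> fix0.
have inj0 : {in G &, injective (fun u : 'S_5 => u 0)}.
  move=> u w uG wG E; apply/eqP; rewrite eq_mulgV1; apply/eqP.
  by apply: fix0; rewrite ?groupM ?groupV // permM E permK.
have oG : #|G| = 5%N.
  apply/eqP; rewrite eqn_leq (dvdn_leq _ dvdn5_card) // andbT.
  by rewrite -(card_in_imset inj0) (leq_trans (max_card _)) ?card_ord.
by rewrite isog_cyclic_card ?prime_cyclic ?oG ?card_Zp.
Qed.

Hypothesis fix01 : forall u : 'S_5, u \in G -> u 0 = 0 -> u 1 = 1 -> u = 1%g.

Lemma fix01_inj (u w : 'S_5) :
  u \in G -> w \in G -> u 0 = w 0 -> u 1 = w 1 -> u = w.
Proof.
move=> uG wG E0 E1; apply/eqP; rewrite eq_mulgV1; apply/eqP.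
by apply: fix01; rewrite ?groupM ?groupV // permM ?E0 ?E1 permK.
Qed.

(** An element is determined by [u 0] and by the sign of [u 1 - u 0], so [G] has order at most 10.
    The involutions [flip5] and [flip5 * rot5] generate a dihedral subgroup that attains this
    bound. *)
Lemma rot5_flip5_isog : flip5 \in G ->
  (forall u : 'S_5, u \in G -> u 0 = 0 -> u 1 = 1 \/ u 1 = -1) -> G \isog 'D_10.
Proof.
move=> flipG fix0.
have u1 (u : 'S_5) : u \in G -> u 1 = u 0 + 1 \/ u 1 = u 0 - 1.
  move=> uG; have wG : (u * rot5 ^+ (- u 0)%R)%g \in G by rewrite groupM ?groupX.
  have wE i : (u * rot5 ^+ (- u 0)%R)%g i = u i - u 0.
    by rewrite permM rot5X natr_ord5.
  have := fix0 _ wG; rewrite !wE subrr => /(_ erefl)[] /eqP.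
    by rewrite subr_eq addrC => /eqP; left.
  by rewrite subr_eq addrC => /eqP; right.
have inj0 : {in G &, injective (fun u : 'S_5 => (u 0, u 1 == u 0 + 1))}.
  move=> u w uG wG [E0 E1]; apply: fix01_inj => //.
  by move: E1; have [->|->] := u1 u uG; have [->|->] := u1 w wG;
    rewrite E0 ?eqxx // !(inj_eq (addrI _)).
have oG : (#|G| <= 10)%N.
  rewrite -(card_in_imset inj0) (leq_trans (max_card _)) //.
  by rewrite card_prod card_ord card_bool.
have flip_order : #[flip5]%g = 2%N.
  apply: nt_prime_order => //.
    by apply/permP=> i; rewrite expgS expg1 permM !flip5E opprK perm1.
  by apply/eqP=> /permP/(_ 1); rewrite flip5E perm1.
have fliprot_order : #[flip5 * rot5]%g = 2%N.
  apply: nt_prime_order => //.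
    apply/permP=> i; rewrite expgS expg1 !permM !flip5E !rot5E perm1.
    by rewrite opprD opprK subrK.
  by apply/eqP=> /permP/(_ 0); rewrite permM flip5E rot5E perm1.
have sDG : <<[set flip5; flip5 * rot5]>>%g \subset G.
  by rewrite gen_subG subUset !sub1set flipG groupM.
have flipD : flip5 \in <<[set flip5; flip5 * rot5]>>%g.
  by rewrite mem_gen // !inE eqxx.
have rotD : rot5 \in <<[set flip5; flip5 * rot5]>>%g.
  by rewrite -(groupMl _ flipD) mem_gen // !inE eqxx orbT.
have oD : #|<<[set flip5; flip5 * rot5]>>%g| = 10%N.
  apply/eqP; rewrite eqn_leq (leq_trans (subset_leq_card sDG)) //=.
  have := order_dvdG flipD; have := order_dvdG rotD.
  rewrite rot5_order flip_order => dvd5 dvd2.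
  by apply: dvdn_leq => //; rewrite (@Gauss_dvd 2 5) // dvd2.
have -> : G :=: <<[set flip5; flip5 * rot5]>>%g.
  by apply/eqP; rewrite eq_sym eqEcard sDG oD.
rewrite -oD; apply: involutions_gen_dihedral => //.
rewrite -{1}[flip5]mulg1 (inj_eq (mulgI _)).
by apply/eqP=> /permP/(_ 0); rewrite rot5E perm1.
Qed.

Hypothesis dblG : dbl5 \in G.

Lemma rot5_dbl5_trans2 i j :
  i != j -> exists u : 'S_5, [/\ u \in G, u 0 = i & u 1 = j].
Proof.
move=> neq_ij.
have [k kE] : exists k, (dbl5 ^+ k)%g 1 = j - i.
  have : j - i != 0 by rewrite subr_eq0 eq_sym.
  have dX m : (dbl5 ^+ m)%g 1 = 2%:R ^+ m.
    elim: m => [|m IH]; first by rewrite perm1.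
    by rewrite expgSr permM IH dbl5E exprSr mulr_natr.
  (* 2 is a primitive root modulo 5; the witnesses 0, 1, 3, 2 are the logarithms to base 2 of 1, 2,
     3, 4. *)
  case: (j - i) => -[|[|[|[|[|//]]]]] lt5 //= _.
  - by exists 0; rewrite dX; apply/val_inj.
  - by exists 1; rewrite dX; apply/val_inj.
  - by exists 3; rewrite dX; apply/val_inj.
  by exists 2; rewrite dX; apply/val_inj.
exists (dbl5 ^+ k * rot5 ^+ i)%g; split; first by rewrite groupM ?groupX.
  rewrite permM rot5X natr_Zp; elim: k {kE} => [|k IH].
    by rewrite perm1 add0r.
  by rewrite expgS permM dbl5E mul0rn.
by rewrite permM kE rot5X natr_ord5 subrK.
Qed.

(** [G] is sharply 2-transitive, so its elements correspond to the $25-5$ ordered pairs of distinct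
    points. *)
Lemma rot5_dbl5_card : #|G| = 20%N.
Proof.
have inj01 : {in G &, injective (fun u : 'S_5 => (u 0, u 1))}.
  by move=> u w uG wG [E0 E1]; apply: fix01_inj.
have injd : injective (fun i : 'I_5 => (i, i)) by move=> i j [].
rewrite -(card_in_imset inj01).
have -> : [set ((u : {perm _}) 0, u 1) | u in G] = ~: [set (i, i) | i : 'I_5].
  apply/setP=> -[i j]; rewrite inE; apply/imsetP/negP=> [[u _ [-> ->]] /imsetP[k _ []]|].
    by move=> <- /perm_inj.
  move=> nd; have neq_ij : i != j.
    by apply/eqP=> eij; apply: nd; rewrite eij imset_f.
  by have [u [uG <- <-]] := rot5_dbl5_trans2 neq_ij; exists u.
by rewrite cardsCs setCK card_imset // card_prod !card_ord.
Qed.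

(** An element fixing two points is conjugate, by 2-transitivity, to one fixing 0 and 1, hence
    trivial. The complement is the stabilizer of 0. *)
Lemma rot5_dbl5_Frobenius : [Frobenius G].
Proof.
apply/existsP; exists 'C_G[0 | 'P]%G; apply/Frobenius_actionP.
apply: (@hasFrobeniusAction _ _ _ _ [set: 'I_5] 'P); split.
- apply/subsetP=> u /setIP[uG /astabP fixu]; apply/set1P.
  by apply: fix01 => //; apply: fixu; rewrite inE.
- apply/imsetP; exists 0; rewrite ?inE //; apply/setP=> i; rewrite inE; symmetry.
  by apply/orbitP; have [u uG <-] := rot5_trans 0 i; exists u.
- move=> u /setD1P[u1 uG]; rewrite leqNgt; apply: contra u1 => /card_gt1P[i [j]].
  rewrite !inE !sub1set !inE /= => -[/eqP ui /eqP uj neq_ij].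
  have [w [wG w0 w1]] := rot5_dbl5_trans2 neq_ij.
  rewrite -(conjg_eq1 _ w^-1); apply/eqP; apply: fix01.
  - by rewrite groupJ ?groupV.
  - by rewrite conjgE invgK !permM w0 [u i]ui -w0 permK.
  by rewrite conjgE invgK !permM w1 [u j]uj -w1 permK.
- apply/trivgPn; exists dbl5.
    by rewrite inE dblG; apply/astab1P; rewrite /= apermE dbl5E mul0rn.
  by apply/eqP=> /permP/(_ 1); rewrite dbl5E perm1.
by exists 0; rewrite ?inE.
Qed.

End FivePoints.

(** * Configurations indexed by Z/5 *)

Section CyclicConfigurations.

Local Open Scope ring_scope.

(* A cyclic shift of the points that is the restriction of a map makes any    *)
(* coincidence propagate to all five points, as 5 is prime.                   *)
Lemma rot5_orbit_inj (V : eqType) (v : 'I_5 -> V) (g : V -> V) :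
  (forall i, v (rot5 i) = g (v i)) -> v 0 != v 1 -> injective v.
Proof.
move=> vE v01 i j eqij; apply/eqP; apply: contraR v01 => neq_ij.
have shift k : v (i + k%:R) = v (j + k%:R).
  elim: k => [|k IH]; first by rewrite !addr0.
  by rewrite -natr1 !addrA -!rot5E !vE IH.
have step k : v k = v (k + (j - i)).
  have := shift (k - i : 'I_5); rewrite natr_ord5 addrC subrK => ->.
  by congr v; rewrite addrC -addrA; congr (_ + _); rewrite addrC.
have all0 m : v 0 = v ((j - i) *+ m).
  by elim: m => [//|m ->]; rewrite mulrS addrC -step.
have [m mE] : exists m, (j - i) *+ m = 1.
  have : j - i != 0 by rewrite subr_eq0 eq_sym.
  case: (j - i) => -[|[|[|[|[|//]]]]] lt5 //= _.
  - by exists 1%N; apply/val_inj.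
  - by exists 3; apply/val_inj.
  - by exists 2; apply/val_inj.
  by exists 4; apply/val_inj.
by rewrite (all0 m) mE.
Qed.

Lemma imset_ord5 (aT : finType) (f : 'I_5 -> aT) :
  [set f i | i : 'I_5] = [set f 0; f 1; f 2%:R; f 3%:R; f 4%:R].
Proof.
apply/setP=> x; rewrite !inE -!orbA; apply/imsetP/idP => [[i _ ->]|].
  by rewrite -(natr_ord5 i); case: i => -[|[|[|[|[|//]]]]] lt5 /=;
    rewrite ?mulr0n ?mulr1n eqxx ?orbT.
by do 4?[case/predU1P=> [->|]]; last move/eqP->; eexists.
Qed.

Lemma sum_ord5 (V : zmodType) (f : 'I_5 -> V) :
  \sum_i f i = f 0 + f 1 + f 2%:R + f 3%:R + f 4%:R.
Proof.
rewrite !big_ord_recl big_ord0 addr0 !addrA.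
by do ?congr (_ + _); congr f; apply/val_inj.
Qed.

Lemma forall_ord5 (D : 'I_5 -> Prop) :
  D 0 -> D 1 -> D 2%:R -> D 3%:R -> D 4%:R -> forall i, D i.
Proof.
move=> D0 D1 D2 D3 D4 i; rewrite -(natr_ord5 i).
by case: i => -[|[|[|[|[|//]]]]] lt5 /=.
Qed.

End CyclicConfigurations.

(** * Explicit points and affine maps in dimensions 2 and 3 *)

Section SmallRows.

Variable F : nzRingType.
Local Open Scope ring_scope.

Definition row_of n (s : seq F) : 'rV[F]_n := \row_j s`_j.
Definition mx_of n (rows : seq (seq F)) : 'M[F]_n :=
  \matrix_(i, j) (nth [::] rows i)`_j.
Definition points_of n (rows : seq (seq F)) (i : 'I_5) : 'rV[F]_n :=
  row_of n (nth [::] rows i).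

Lemma row2P (x y : 'rV[F]_2) : x 0 0 = y 0 0 -> x 0 1 = y 0 1 -> x = y.
Proof.
move=> e0 e1; apply/rowP=> -[[|[|//]] lt2].
  by rewrite (_ : Ordinal lt2 = 0) //; apply/val_inj.
by rewrite (_ : Ordinal lt2 = 1) //; apply/val_inj.
Qed.

Lemma row3P (x y : 'rV[F]_3) :
  x 0 0 = y 0 0 -> x 0 1 = y 0 1 -> x 0 2%:R = y 0 2%:R -> x = y.
Proof.
move=> e0 e1 e2; apply/rowP=> -[[|[|[|//]]] lt3].
- by rewrite (_ : Ordinal lt3 = 0) //; apply/val_inj.
- by rewrite (_ : Ordinal lt3 = 1) //; apply/val_inj.
by rewrite (_ : Ordinal lt3 = 2%:R) //; apply/val_inj.
Qed.

Lemma affine2E (x c : 'rV[F]_2) (L : 'M[F]_2) j :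
  (x *m L + c) 0 j = x 0 0 * L 0 j + x 0 1 * L 1 j + c 0 j.
Proof.
rewrite !mxE !big_ord_recl big_ord0 addr0.
by rewrite (_ : lift _ _ = 1) //; apply/val_inj.
Qed.

Lemma affine3E (x c : 'rV[F]_3) (L : 'M[F]_3) j :
  (x *m L + c) 0 j = x 0 0 * L 0 j + x 0 1 * L 1 j + x 0 2%:R * L 2%:R j + c 0 j.
Proof.
rewrite !mxE !big_ord_recl big_ord0 addr0 addrA.
rewrite (_ : lift _ (lift _ _) = 2%:R); last exact/val_inj.
by rewrite (_ : lift _ _ = 1) //; apply/val_inj.
Qed.

End SmallRows.

Lemma mulr1_inv (F : fieldType) (x y : F) : (x * y = 1 -> x^-1 = y)%R.
Proof.
move=> xy1; have x0 : (x != 0)%R.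
  by apply/eqP=> x0; move/eqP: xy1; rewrite x0 mul0r eq_sym oner_eq0.
by apply: (mulfI x0); rewrite xy1 divff.
Qed.

(** * The first planar configuration *)

Section CGD1.

Variable p : nat.
Hypothesis p_pr : prime p.
Local Open Scope ring_scope.
Variable l : 'F_p.
Hypothesis l_root : 1 + l + l ^+ 2 + l ^+ 3 + l ^+ 4 = 0.

(** As a rewriting rule in [ring: l4], it reduces polynomials in [l] modulo the fifth cyclotomic
    polynomial. *)
Let l4 : l ^+ 4 = - (1 + l + l ^+ 2 + l ^+ 3).
Proof. by apply/eqP; rewrite -addr_eq0 addrC l_root. Qed.

Lemma root5_inv : l^-1 = l ^+ 4.
Proof. by apply: mulr1_inv; ring: l4. Qed.

Lemma root5_inv_succ : (l + 1)^-1 = - (l + l ^+ 3).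
Proof. by apply: mulr1_inv; ring: l4. Qed.

Definition CGD1_points : 'I_5 -> 'rV['F_p]_2 := points_of 2
  [:: [:: 0; 0]; [:: 1; 0]; [:: - (l ^+ 2 + l ^+ 4); l ^+ 4];
      [:: l; - (l + l ^+ 3)]; [:: 0; 1]].
Local Notation v := CGD1_points.

(** The points 0, 1, 4 are the origin and the basis, and go to 1, 2, 0. This forces the rows
    [v 2 - v 1], [v 0 - v 1] and the constant [v 1]; what remains to hold is that 2 goes to 3 and 3
    to 4. *)
Lemma CGD1_rot i :
  v (rot5 i) = v i *m mx_of 2 [:: [:: - (l ^+ 2 + l ^+ 4) - 1; l ^+ 4]; [:: -1; 0]]
             + row_of 2 [:: 1; 0].
Proof.
rewrite rot5E; elim/forall_ord5: i; apply: row2P;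
  rewrite affine2E !mxE /=; ring: l4.
Qed.

Lemma CGD1_points_inj : injective v.
Proof.
apply: (rot5_orbit_inj (g := fun w => w *m _ + _) CGD1_rot).
apply/eqP=> /rowP/(_ 0).
by rewrite !mxE /= => /eqP; rewrite eq_sym oner_eq0.
Qed.

Definition CGD1_basis (k : 'I_2) : 'I_5 := if k == 0 then 1 else 4%:R.

Lemma CGD1_basisE k : v (CGD1_basis k) = delta_mx 0 k.
Proof.
by case: k => -[|[|//]] lt2; apply: row2P; rewrite /CGD1_basis !mxE /=.
Qed.

Lemma CGD1_points0 : v 0 = 0.
Proof. by apply: row2P; rewrite !mxE. Qed.

Lemma CGD1_setE : CGD1_set l = [set GD_point v i | i : 'I_5].
Proof.
rewrite imset_ord5 /CGD1_set root5_inv root5_inv_succ.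
have -> : l * - (l + l ^+ 3) = - (l ^+ 2 + l ^+ 4) by ring.
by congr [set _; _; _; _; _]; rewrite ?GD_genXF // /GD_gen /GD_h ?GD_mul0;
  congr (_, _); apply: row2P; rewrite !mxE /=; ring.
Qed.

Local Notation CGD1_sym := (affine_sym CGD1_points_inj).

Lemma CGD1_rot_sym : rot5 \in CGD1_sym.
Proof. exact: (mem_affine_sym CGD1_points_inj CGD1_points0 CGD1_basisE CGD1_rot). Qed.

(* The points are affinely equivalent to (l ^+ (3 * i), l ^+ i); these two    *)
(* coordinates are the eigenfunctions of the rotation.                        *)
Lemma CGD1_eigen3 (i : 'I_5) :
  l ^+ (3 * i) = 1 + (l ^+ 3 - 1) * v i 0 0 + (l ^+ 2 - 1) * v i 0 1.
Proof. by elim/forall_ord5: i; rewrite !mxE /=; ring: l4. Qed.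

Lemma CGD1_eigen1 (i : 'I_5) :
  l ^+ i = 1 + (l - 1) * v i 0 0 + (l ^+ 4 - 1) * v i 0 1.
Proof. by elim/forall_ord5: i; rewrite !mxE /=; ring: l4. Qed.

Hypotheses (l_neq1 : l - 1 != 0) (l_neqN1 : l + 1 != 0).
Hypothesis five_neq0 : 5%:R != 0 :> 'F_p.
Hypothesis three_neq0 : 3%:R != 0 :> 'F_p.
Hypothesis p_odd : odd p.

Let l5 : l ^+ 5 = 1. Proof. by ring: l4. Qed.

Lemma root5_exp_inj (i j : 'I_5) : l ^+ i = l ^+ j -> i = j.
Proof.
have X_neq1 k : (0 < k < 5)%N -> l ^+ k <> 1.
  move=> k_bound lk; suff /eqP : l = 1 by rewrite -subr_eq0 (negPf l_neq1).
  case: k k_bound lk => [|[|[|[|[|//]]]]] // _ lk.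
  - have <- : (l ^+ 2) ^+ 3 = l by ring: l4.
    by rewrite lk expr1n.
  - have <- : (l ^+ 3) ^+ 2 = l by ring: l4.
    by rewrite lk expr1n.
  have <- : (l ^+ 4) ^+ 4 = l by ring: l4.
    by rewrite lk expr1n.
have l_neq0 : l != 0.
  by apply/eqP=> l0; have /eqP := l5; rewrite l0 expr0n eq_sym oner_eq0.
wlog lt_ij : i j / (i < j)%N.
  move=> W E; have [||/val_inj//] := ltngtP i j; first by move/W; apply.
  by move/W/(_ (esym E)).
move=> E; case: (X_neq1 (j - i)%N).
  by rewrite subn_gt0 lt_ij (leq_ltn_trans (leq_subr _ _)).
apply: (mulfI (expf_neq0 i l_neq0)).
by rewrite -exprD subnKC ?(ltnW lt_ij) // mulr1 -E.
Qed.

(* The eigenfunction w = l ^+ (3 * u i) is a combination X l^(3i) + Y l^i of   *)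
(* the two eigenfunctions; as u only permutes the fifth roots of unity, the    *)
(* sum of the cubes of w is 0, and it equals 15 X Y^2 up to a constant.        *)
Lemma CGD1_fix0 (u : 'S_5) : u \in CGD1_sym -> u 0 = 0 -> u = 1%g.
Proof.
move=> uG u0.
have [L [c vE]] := affine_symP p_pr CGD1_points0 p_odd uG.
have c0 : c = 0 by have := vE 0; rewrite u0 CGD1_points0 mul0mx add0r.
have coord i j : v (u i) 0 j = v i 0 0 * L 0 j + v i 0 1 * L 1 j.
  by rewrite vE affine2E c0 [X in _ + X]mxE addr0.
pose A := (l ^+ 3 - 1) * L 0 0 + (l ^+ 2 - 1) * L 0 1.
pose B := (l ^+ 3 - 1) * L 1 0 + (l ^+ 2 - 1) * L 1 1.
have wE i : l ^+ (3 * u i) = 1 + A * v i 0 0 + B * v i 0 1.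
  by rewrite CGD1_eigen3 !coord /A /B; ring.
(* [X], [Y] and [Z] are the discrete Fourier coefficients $\sum_i w_i\ell^{-3i}$, $\sum_i
   w_i\ell^{-i}$ and $\sum_i w_i$ of $w_i=\ell^{3u(i)}$. *)
pose X := A * (2%:R * l ^+ 2 - l - l ^+ 3) + B * (2%:R * l ^+ 3 - l ^+ 2 - l ^+ 4).
pose Y := A * (l ^+ 4 - 1 - l ^+ 2 + l ^+ 3) + B * (l ^+ 2 - l ^+ 3 - 1 + l).
pose Z := \sum_i l ^+ (3 * u i).
have fourier i : 5%:R * l ^+ (3 * u i) = X * l ^+ (3 * i) + Y * l ^+ i + Z.
  rewrite /Z (eq_bigr _ (fun i _ => wE i)) sum_ord5 wE /X /Y.
  by elim/forall_ord5: i; rewrite !mxE /=; ring: l4.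
have sum_u (f : 'I_5 -> 'F_p) : \sum_i f (u i) = \sum_i f i.
  by rewrite [RHS](reindex_perm u).
have Z0 : Z = 0.
  rewrite /Z (sum_u (fun i => l ^+ (3 * i))).
  by rewrite sum_ord5 /=; ring: l4.
have : \sum_i (5%:R * l ^+ (3 * u i)) ^+ 3 = 0.
  under eq_bigr do rewrite exprMn -exprM.
  rewrite (sum_u (fun i => 5%:R ^+ 3 * l ^+ (3 * i * 3))).
  by rewrite sum_ord5 /=; ring: l4.
under eq_bigr do rewrite fourier Z0 addr0.
(* The cube involves $\ell^{9i},\ell^{7i},\ell^{5i},\ell^{3i}$; only $\ell^{5i}=1$ has a nonzero sum
   over [i]. *)
have -> : \sum_(i < 5) (X * l ^+ (3 * i) + Y * l ^+ i) ^+ 3 = 3%:R * 5%:R * (X * Y ^+ 2).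
  by rewrite sum_ord5 /=; ring: l4.
have XY : X + Y = 5%:R.
  have := fourier 0; rewrite u0 Z0 muln0 !expr0 !mulr1 addr0.
  by move->.
have X6 k : l ^+ k = (l ^+ (3 * k)) ^+ 2.
  by rewrite -exprM mulnAC exprM (_ : l ^+ (3 * 2) = l) //; ring: l4.
move/eqP; rewrite !mulf_eq0 (negPf five_neq0) (negPf three_neq0) /= orbb.
case/orP=> /eqP XY0.
  (* If $X=0$, then [u] doubles the indices, and $\ell^{2i}$ would be an affine function of the
     points. Its coefficients are read off at the points 1 and 4; the point 3 then gives
     $(\ell-1)^3(\ell+1)=0$, a contradiction. *)
  have u13 i : l ^+ (3 * u i) = l ^+ i.
    apply: (mulfI five_neq0); rewrite fourier Z0 addr0 XY0 mul0r add0r.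
    by rewrite -XY XY0 add0r.
  have u2 i : l ^+ u i = l ^+ (2 * i).
    by rewrite X6 u13 -exprM mulnC.
  pose A' := (l - 1) * L 0 0 + (l ^+ 4 - 1) * L 0 1.
  pose B' := (l - 1) * L 1 0 + (l ^+ 4 - 1) * L 1 1.
  have w'E (i : 'I_5) : l ^+ (2 * i) = 1 + A' * v i 0 0 + B' * v i 0 1.
    by rewrite -u2 CGD1_eigen1 !coord /A' /B'; ring.
  have EA : A' = l ^+ 2 - 1.
    by have := w'E 1; rewrite !mxE /= muln1 mulr1 mulr0 addr0 => ->; ring.
  have EB : B' = l ^+ 3 - 1.
    by have := w'E 4%:R; rewrite !mxE /= mulr0 addr0 mulr1 addrC => /(canLR (addrK _)) <-; ring: l4.
  have /eqP := w'E 3%:R; rewrite -subr_eq0 EA EB !mxE /=.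
  have -> : l ^+ (2 * 3) - (1 + (l ^+ 2 - 1) * l + (l ^+ 3 - 1) * (- (l + l ^+ 3)))
      = (l - 1) ^+ 3 * (l + 1) by ring: l4.
  by rewrite mulf_eq0 expf_eq0 (negPf l_neq1) (negPf l_neqN1).
(* If $Y=0$, then $X=5$ and [u] preserves the eigenfunction $\ell^{3i}$, hence its square
   $\ell^i$. *)
apply/permP=> i; rewrite perm1; apply: root5_exp_inj.
have u3 : l ^+ (3 * u i) = l ^+ (3 * i).
  apply: (mulfI five_neq0); rewrite fourier Z0 !addr0 XY0 mul0r addr0.
  by rewrite -XY XY0 addr0.
by rewrite X6 u3 -X6.
Qed.

End CGD1.

(** * The first planar configuration for p = 5 *)

Section CGD1Five.

Local Open Scope ring_scope.
Local Notation v := (CGD1_points (1 : 'F_5)).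
Hypothesis root1 : (1 + 1 + 1 ^+ 2 + 1 ^+ 3 + 1 ^+ 4 : 'F_5) = 0.
Local Notation CGD1_sym := (affine_sym (CGD1_points_inj root1)).

(** Over $\mathbb{F}_5$ the point [i] is $(3i^2+3i,3i^2+2i)$, and doubling [i] acts linearly on
    $(i,i^2)$. The rows of the matrix are the points 2 and 3, the images of 1 and 4. *)
Lemma CGD1_five_dbl_sym : dbl5 \in CGD1_sym.
Proof.
apply: (mem_affine_sym _ (CGD1_points0 _) (CGD1_basisE _)
  (L := mx_of 2 [:: [:: 3%:R; 1]; [:: 1; 3%:R]]) (c := 0)) => i.
rewrite dbl5E; elim/forall_ord5: i; apply: row2P;
  rewrite affine2E !mxE /=; exact/val_inj.
Qed.

(** The linear map is determined by the image of the point 4. Since [v 2 = 3 v 1 + v 4], that image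
    plus [3 v 1] must again be a point, and a finite check leaves only 4. *)
Lemma CGD1_five_fix01 (u : 'S_5) : u \in CGD1_sym -> u 0 = 0 -> u 1 = 1 -> u = 1%g.
Proof.
move=> uG u0 u1.
have [L [c vE]] := affine_symP (isT : prime 5) (CGD1_points0 _) (isT : odd 5) uG.
have c0 : c = 0 by have := vE 0; rewrite u0 CGD1_points0 mul0mx add0r.
have coord i j : v (u i) 0 j = v i 0 0 * L 0 j + v i 0 1 * L 1 j.
  by rewrite vE affine2E c0 [X in _ + X]mxE addr0.
have L0 j : L 0 j = v 1 0 j.
  by have := coord 1 j; rewrite u1 => ->; rewrite !mxE /= mul1r mul0r addr0.
have L1 j : L 1 j = v (u 4%:R) 0 j.
  by rewrite coord !mxE /= mul1r mul0r add0r.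
have v2E j : v (u 2%:R) 0 j = 3%:R * v 1 0 j + v (u 4%:R) 0 j.
  rewrite (coord 2%:R) L0 L1; move: (v (u 4%:R) 0 j) => y.
  by rewrite !mxE /= !expr1n mul1r; congr (_ * _ + _); exact/val_inj.
have u4 : u 4%:R = 4%:R.
  have u4_neq0 : u 4%:R != 0 by rewrite -u0 (inj_eq perm_inj).
  have u4_neq1 : u 4%:R != 1 by rewrite -{2}u1 (inj_eq perm_inj).
  have /andP[] : (v (u 2%:R) 0 0 == 3%:R * v 1 0 0 + v (u 4%:R) 0 0)
              && (v (u 2%:R) 0 1 == 3%:R * v 1 0 1 + v (u 4%:R) 0 1).
    by rewrite !v2E !eqxx.
  move: (u 4%:R) (u 2%:R) u4_neq0 u4_neq1 => j k; rewrite !mxE.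
  by elim/forall_ord5: j => // _ _; elim/forall_ord5: k.
apply/permP=> i; rewrite perm1; apply: (CGD1_points_inj root1).
apply: row2P; rewrite coord !L0 !L1 u4; elim/forall_ord5: i;
  rewrite !mxE; exact/val_inj.
Qed.

End CGD1Five.

(** * The affinely regular pentagon *)

Section CGD2.

Variable p : nat.
Hypothesis p_pr : prime p.
Local Open Scope ring_scope.
Variable m : 'F_p.
Hypothesis m_root : m ^+ 2 = m + 1.

(** With [m] a golden ratio, each diagonal of this pentagon is [m] times the parallel side. *)
Definition CGD2_points : 'I_5 -> 'rV['F_p]_2 := points_of 2
  [:: [:: 0; 0]; [:: 1; 0]; [:: m; 1]; [:: 1; m]; [:: 0; 1]].
Local Notation v := CGD2_points.

Lemma CGD2_rot i :
  v (rot5 i) = v i *m mx_of 2 [:: [:: m - 1; 1]; [:: -1; 0]] + row_of 2 [:: 1; 0].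
Proof.
rewrite rot5E; elim/forall_ord5: i; apply: row2P;
  rewrite affine2E !mxE /=; ring: m_root.
Qed.

Lemma CGD2_points_inj : injective v.
Proof.
apply: (rot5_orbit_inj (g := fun w => w *m _ + _) CGD2_rot).
apply/eqP=> /rowP/(_ 0).
by rewrite !mxE /= => /eqP; rewrite eq_sym oner_eq0.
Qed.

Lemma CGD2_basisE k : v (CGD1_basis k) = delta_mx 0 k.
Proof.
by case: k => -[|[|//]] lt2; apply: row2P; rewrite /CGD1_basis !mxE /=.
Qed.

Lemma CGD2_points0 : v 0 = 0.
Proof. by apply: row2P; rewrite !mxE. Qed.

Local Notation CGD2_sym := (affine_sym CGD2_points_inj).

Lemma CGD2_rot_sym : rot5 \in CGD2_sym.
Proof. exact: (mem_affine_sym CGD2_points_inj CGD2_points0 CGD2_basisE CGD2_rot). Qed.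

Lemma CGD2_flip_sym : flip5 \in CGD2_sym.
Proof.
apply: (mem_affine_sym CGD2_points_inj CGD2_points0 CGD2_basisE
  (L := mx_of 2 [:: [:: 0; 1]; [:: 1; 0]]) (c := 0)) => i.
rewrite flip5E; elim/forall_ord5: i; apply: row2P;
  rewrite affine2E !mxE /=; ring.
Qed.

Hypothesis five_neq0 : 5%:R != 0 :> 'F_p.
Hypothesis p_odd : odd p.

(* The form x + y takes the values 0, 1, m + 1, m + 1, 1; u preserves its sum, *)
(* which forces its values at the images of the points 1 and 4 to add up to 2. *)
Lemma CGD2_fix0 (u : 'S_5) : u \in CGD2_sym -> u 0 = 0 ->
  (u 1 = 1 \/ u 1 = -1) /\ (u 1 = 1 -> u = 1%g).
Proof.
move=> uG u0.
have [L [c vE]] := affine_symP p_pr CGD2_points0 p_odd uG.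
have c0 : c = 0 by have := vE 0; rewrite u0 CGD2_points0 mul0mx add0r.
have coord i j : v (u i) 0 j = v i 0 0 * L 0 j + v i 0 1 * L 1 j.
  by rewrite vE affine2E c0 [X in _ + X]mxE addr0.
have L0 j : L 0 j = v (u 1) 0 j by rewrite coord !mxE /= mul1r mul0r addr0.
have L1 j : L 1 j = v (u 4%:R) 0 j by rewrite coord !mxE /= mul1r mul0r add0r.
pose phi i := v i 0 0 + v i 0 1.
have phi_u i : phi (u i) = v i 0 0 * phi (u 1) + v i 0 1 * phi (u 4%:R).
  by rewrite /phi (coord i 0) (coord i 1) !L0 !L1; ring.
have m_neq0 : m != 0.
  by apply/eqP=> m0; have /eqP := m_root; rewrite m0 expr0n add0r eq_sym oner_eq0.
have m2_neq0 : m + 2%:R != 0.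
  apply: contra five_neq0; rewrite addr_eq0 => /eqP mE; apply/eqP.
  have -> : 5%:R = (- 2%:R) ^+ 2 - (- 2%:R + 1) :> 'F_p by ring.
  by rewrite -mE m_root subrr.
have sumE s t : \sum_i (v i 0 0 * s + v i 0 1 * t) = (m + 2%:R) * (s + t).
  by rewrite sum_ord5 !mxE /=; ring.
have phi14 : phi (u 1) + phi (u 4%:R) = 2%:R.
  apply: (mulfI m2_neq0); rewrite -sumE -(eq_bigr _ (fun i _ => phi_u i)).
  have <- : \sum_i phi i = (m + 2%:R) * 2%:R.
    rewrite (_ : 2%:R = 1 + 1) // -sumE.
    by apply: eq_bigr => i _; rewrite !mulr1.
  by rewrite [RHS](reindex_perm u).
have phiP i : i != 0 -> phi i = 1 /\ (i = 1 \/ i = -1) \/ phi i = m + 1.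
  by rewrite /phi; elim/forall_ord5: i => //= _; rewrite !mxE /=;
    do [right; ring | left; split; [ring | (left + right); exact/val_inj]].
have neq0 i : i != 0 -> u i != 0 by rewrite -{2}u0 (inj_eq perm_inj).
(* The other possible sums of two values exceed 2 by [m] and [2 m], both nonzero; so both values are
   1 and [u] permutes the points 1 and 4. *)
have bad1 : 1 + (m + 1) != 2%:R by rewrite -subr_eq0 (_ : _ - _ = m) //; ring.
have bad2 : (m + 1) + (m + 1) != 2%:R.
  rewrite -subr_eq0 (_ : _ - _ = 2%:R * m) ?mulf_neq0 //; last ring.
  rewrite -(dvdn_pcharf (pchar_Fp p_pr)) dvdn_prime2 //.
  by apply: contraL p_odd => /eqP->.
have u1 : phi (u 1) = 1 /\ (u 1 = 1 \/ u 1 = -1).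
  have [//|phi1] := phiP _ (neq0 1 isT); move/eqP: phi14; rewrite phi1.
  have [[-> _]|->] := phiP _ (neq0 4%:R isT); first by rewrite addrC (negPf bad1).
  by rewrite (negPf bad2).
have u4 : u 4%:R = 1 \/ u 4%:R = -1.
  have [[//]|phi4] := phiP _ (neq0 4%:R isT); move/eqP: phi14.
  by rewrite (proj1 u1) phi4 (negPf bad1).
split=> [|u1E]; first by case: u1.
have {u4} u4E : u 4%:R = 4%:R.
  case: u4 => [|->]; last exact/val_inj.
  by rewrite -{2}u1E => /perm_inj.
apply/permP=> i; rewrite perm1; apply: CGD2_points_inj.
apply: row2P; rewrite coord !L0 !L1 u1E u4E; elim/forall_ord5: i;
  rewrite !mxE /=; ring.
Qed.

End CGD2.

Section CGD2Set.

Variable p : nat.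
Local Open Scope ring_scope.
Variable lambda : 'F_p.
Local Notation v := (CGD2_points (2%:R^-1 * (1 + lambda))).

Lemma CGD2_setE : CGD2_set lambda = [set GD_point v i | i : 'I_5].
Proof.
rewrite imset_ord5 /CGD2_set; move: (2%:R^-1 * _) => m.
by congr [set _; _; _; _; _]; rewrite ?GD_genXF // /GD_gen /GD_h ?GD_mul0;
  congr (_, _); apply: row2P; rewrite !mxE /=; ring.
Qed.

End CGD2Set.

(** * The configuration in dimension 3 *)

Section CGD3.

Variable p : nat.
Hypothesis p_pr : prime p.
Local Open Scope ring_scope.
Variable l : 'F_p.
Hypothesis l_root : 1 + l + l ^+ 2 + l ^+ 3 + l ^+ 4 = 0.

Let l4 : l ^+ 4 = - (1 + l + l ^+ 2 + l ^+ 3).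
Proof. by apply/eqP; rewrite -addr_eq0 addrC l_root. Qed.

Definition CGD3_points : 'I_5 -> 'rV['F_p]_3 := points_of 3
  [:: [:: 0; 0; 0]; [:: 1; 0; 0]; [:: 0; 1; 0];
      [:: - l ^+ 2; - l; - l ^+ 4]; [:: 0; 0; 1]].
Local Notation v := CGD3_points.

(** Up to a scalar, the only affine relation is $\sum_i \ell^{3-i}v_i=0$, which a cyclic shift
    multiplies by a power of $\ell$. The matrix is forced by the images of the origin and of the
    basis points 1, 2, 4. *)
Lemma CGD3_rot i :
  v (rot5 i) = v i *m mx_of 3 [:: [:: -1; 1; 0]; [:: - l ^+ 2 - 1; - l; - l ^+ 4];
                                  [:: -1; 0; 0]]
             + row_of 3 [:: 1; 0; 0].
Proof.
rewrite rot5E; elim/forall_ord5: i; apply: row3P;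
  rewrite affine3E !mxE /=; ring: l4.
Qed.

Lemma CGD3_points_inj : injective v.
Proof.
apply: (rot5_orbit_inj (g := fun w => w *m _ + _) CGD3_rot).
apply/eqP=> /rowP/(_ 0).
by rewrite !mxE /= => /eqP; rewrite eq_sym oner_eq0.
Qed.

Definition CGD3_basis (k : 'I_3) : 'I_5 := nth 0 [:: 1; 2%:R; 4%:R] k.

Lemma CGD3_basisE k : v (CGD3_basis k) = delta_mx 0 k.
Proof.
by case: k => -[|[|[|//]]] lt3; apply: row3P; rewrite /CGD3_basis !mxE /=.
Qed.

Lemma CGD3_points0 : v 0 = 0.
Proof. by apply: row3P; rewrite !mxE. Qed.

Lemma CGD3_setE : CGD3_set l = [set GD_point v i | i : 'I_5].
Proof.
rewrite imset_ord5 /CGD3_set (root5_inv l_root).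
by congr [set _; _; _; _; _]; rewrite ?GD_genXF // /GD_gen /GD_h ?GD_mul0;
  congr (_, _); apply: row3P; rewrite !mxE /=; ring.
Qed.

Local Notation CGD3_sym := (affine_sym CGD3_points_inj).

Lemma CGD3_rot_sym : rot5 \in CGD3_sym.
Proof. exact: (mem_affine_sym CGD3_points_inj CGD3_points0 CGD3_basisE CGD3_rot). Qed.

(* At l = 1 the only affine relation between the points has all its           *)
(* coefficients equal, so it survives every permutation.                      *)
Lemma CGD3_sym_full : l = 1 -> CGD3_sym :=: [set: 'S_5].
Proof.
move=> l1; apply/setP=> u; rewrite inE.
have five0 : 5%:R = 0 :> 'F_p by rewrite -[RHS]l_root l1; ring.
have sum_v : \sum_i v i = 0.
  by rewrite sum_ord5; apply: row3P; rewrite !mxE /= l1; ring.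
have sum_vu : \sum_i v (u i) = 0 by rewrite -[RHS]sum_v [RHS](reindex_perm u).
pose L := \matrix_k (v (u (CGD3_basis k)) - v (u 0)).
apply: (mem_affine_sym CGD3_points_inj CGD3_points0 CGD3_basisE
  (L := L) (c := v (u 0))) => i.
have basisE k : v (CGD3_basis k) *m L + v (u 0) = v (u (CGD3_basis k)).
  by rewrite CGD3_basisE -rowE rowK subrK.
have LE k : v (CGD3_basis k) *m L = v (u (CGD3_basis k)) - v (u 0).
  by rewrite -basisE addrK.
have v3E : v 3%:R = - v 1 - v 2%:R - v 4%:R.
  by apply: row3P; rewrite !mxE /= l1; ring.
elim/forall_ord5: i.
- by rewrite CGD3_points0 mul0mx add0r.
- exact: esym (basisE 0).
- exact: esym (basisE 1).
(* The point 3 is the only one not handled by the choice of [L]; there the two sides differ by the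
   sum of all [v (u i)] minus [5 v (u 0)], and both terms vanish. *)
- rewrite v3E !mulmxDl !mulNmx (LE 0) (LE 1) (LE 2%:R) /CGD3_basis /=.
  move: sum_vu; rewrite sum_ord5.
  move: (v (u 0)) (v (u 1)) (v (u 2%:R)) (v (u 3%:R)) (v (u 4%:R)).
  move=> a0 a1 a2 a3 a4 sum_a; apply/rowP=> j.
  move/rowP/(_ j): sum_a; rewrite !mxE => sum_aj.
  apply/eqP; rewrite -subr_eq0; apply/eqP.
  transitivity (a0 0 j + a1 0 j + a2 0 j + a3 0 j + a4 0 j - 5%:R * a0 0 j).
    by ring.
  by rewrite sum_aj five0 mul0r subrr.
exact: esym (basisE 2%:R).
Qed.

End CGD3.

(** * The simplex in dimension 4 *)

Section CGD4.

Variable p : nat.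
Local Open Scope ring_scope.

Definition CGD4_points (i : 'I_5) : 'rV['F_p]_4 :=
  oapp (delta_mx 0) 0 (unlift ord0 i).
Local Notation v := CGD4_points.

Lemma CGD4_basisE k : v (lift ord0 k) = delta_mx 0 k.
Proof. by rewrite /v liftK. Qed.

Lemma CGD4_points0 : v 0 = 0.
Proof. by rewrite /v unlift_none. Qed.

Lemma CGD4_points_inj : injective v.
Proof.
have delta_inj : injective (delta_mx 0 : 'I_4 -> 'rV['F_p]_4).
  move=> i j /rowP/(_ i); rewrite !mxE !eqxx /=.
  by case: (i =P j) => // _ /eqP; rewrite oner_eq0.
have delta_neq0 i : delta_mx 0 i != 0 :> 'rV['F_p]_4.
  by apply/eqP=> /rowP/(_ i)/eqP; rewrite !mxE !eqxx oner_eq0.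
move=> i j; rewrite /v.
case: unliftP => [i' ->|->]; case: unliftP => [j' ->|->] //= /eqP.
- by move/eqP/delta_inj=> ->.
- by rewrite (negPf (delta_neq0 _)).
by rewrite eq_sym (negPf (delta_neq0 _)).
Qed.

Lemma CGD4_setE : CGD4_set p = [set GD_point v i | i : 'I_5].
Proof.
rewrite imset_ord5 /CGD4_set.
have genE (k : 'I_4) : (GD_gen p 4 k * GD_h p 4)%g = GD_point v (lift ord0 k).
  rewrite /GD_gen /GD_h GD_mul0 addr0 /GD_point CGD4_basisE.
  by congr (_, _); apply/rowP=> j; rewrite !mxE.
have := (genE 0, genE 1, genE 2%:R, genE 3%:R) => /= -[[[E0 E1] E2] E3].
rewrite E0 E1 E2 E3 /GD_h -CGD4_points0.
by congr [set _; _; _; _; _]; congr GD_point; apply/val_inj.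
Qed.

Local Notation CGD4_sym := (affine_sym CGD4_points_inj).

(** The points are affinely independent, so any choice of images extends to an affine map. *)
Lemma CGD4_sym_full : CGD4_sym :=: [set: 'S_5].
Proof.
apply/setP=> u; rewrite inE.
apply: (mem_affine_sym CGD4_points_inj CGD4_points0 CGD4_basisE
  (L := \matrix_k (v (u (lift ord0 k)) - v (u 0))) (c := v (u 0))) => i.
case: (unliftP ord0 i) => [k ->|->].
  by rewrite CGD4_basisE -rowE rowK subrK.
by rewrite CGD4_points0 mul0mx add0r.
Qed.

End CGD4.

(** * Consequences of the rotation being affine *)

Section Configuration.

Variables (p n : nat).
Hypothesis p_pr : prime p.
Local Open Scope ring_scope.
Variables (v : 'I_5 -> 'rV['F_p]_n) (b : 'I_n -> 'I_5).
Hypotheses (v_inj : injective v) (v0 : v 0 = 0).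
Hypothesis v_basis : forall k, v (b k) = delta_mx 0 k.
Hypothesis rot_sym : rot5 \in affine_sym v_inj.

Local Notation S := [set GD_point v i | i : 'I_5].
Local Notation R := (right_regular (GD p n)).

Lemma point_arc_transitive (P : {group {perm GD p n}}) : P \in 'Syl_p(R) ->
  arc_transitive (Cay S) 'N_(graph_aut (Cay S))(P).
Proof.
move=> sylP; pose N := ('N_(graph_aut_group (Cay S))(P))%G.
apply: (@conn_sym_trans _ _ _ (GD_point_inj v_inj) N).
- exact: subsetIl.
- exact: right_regular_norm_sylow.
- exact: conn_aut_norm_sylow.
exact: rot5_trans.
Qed.

Lemma point_isog : conn_aut S \isog affine_sym v_inj.
Proof. exact: GD_conn_isog v0 v_basis. Qed.

(** The complement is generated by the automorphism inducing [rot5], which has order 5 because the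
    action on the points is faithful. *)
Lemma point_rotation_sdprod : exists M K : {group {perm GD p n}},
  [/\ R ><| K = M, K \isog Zp 5 & M \subset 'N_(graph_aut (Cay S))(R)].
Proof.
have /morphimP[f _ fK fE] := rot_sym.
have of5 : #[f]%g = 5%N.
  rewrite -(order_injm (injm_conn_perm (GD_point_inj v_inj)
                          (GD_point_gen v0 v_basis)) fK).
  by rewrite -fE rot5_order.
have defN := sdprod_right_regular S.
have sfK : <[f]>%g \subset conn_aut S by rewrite cycle_subG.
exists (R <*> <[f]>)%G, <[f]>%G; split.
- exact: sdprod_subr defN sfK.
- by rewrite isog_cyclic_card ?cycle_cyclic // prime_cyclic card_Zp // -orderE of5.
by rewrite /= join_subG -(sdprodWY defN) joing_subl (subset_trans sfK) // joing_subr.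
Qed.

End Configuration.

(** * Arithmetic of the parameter l *)

Section EllSpec.

Variables (p : nat) (l : {unit 'F_p}).
Hypothesis p_pr : prime p.
Hypothesis l_spec : ell_spec l.
Local Open Scope ring_scope.
Local Notation x := (val l).

Lemma ell_five : p = 5%N -> x = 1.
Proof.
by case: l_spec => [[_ ->] //|[dvd5 _] p5]; move: dvd5; rewrite {1}p5.
Qed.

(** This relation unifies the two cases: at $\ell=1$ it reads $5=0$, and for $\ell$ of order 5 it is
    $\ell^5-1=0$ divided by $\ell-1$. *)
Lemma ell_root : 1 + x + x ^+ 2 + x ^+ 3 + x ^+ 4 = 0.
Proof.
case: l_spec => [[p5 ->]|[_ ol]].
  have five0 : 5%:R = 0 :> 'F_p by rewrite -(pchar_Fp_0 p_pr) [X in _ = X%:R]p5.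
  by rewrite -[RHS]five0 FinRing.val_unit1; ring.
have x5 : x ^+ 5 = 1 by rewrite -FinRing.val_unitX -ol expg_order.
have x1 : x - 1 != 0.
  rewrite subr_eq0; apply/eqP=> x1; have /eqP := ol.
  by rewrite (_ : l = 1%g) ?order1 //; apply: val_inj.
apply: (mulfI x1); rewrite mulr0.
by transitivity (x ^+ 5 - 1); [ring | rewrite x5 subrr].
Qed.

Hypothesis p5 : (5 %| p.-1)%N.

Lemma ell_odd : odd p.
Proof. by have [p2|//] := even_prime p_pr; move: p5; rewrite p2. Qed.

Lemma ell_nat_neq0 q : prime q -> (q < 11)%N -> q%:R != 0 :> 'F_p.
Proof.
move=> q_pr q11; rewrite -(dvdn_pcharf (pchar_Fp p_pr)) dvdn_prime2 //.
apply: contraL p5 => /eqP->; move: q_pr q11.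
by do 11?[case: q => [|q] //].
Qed.

Lemma ell_neq1 : x - 1 != 0.
Proof.
case: l_spec => [[pE _]|[_ ol]]; first by move: p5; rewrite {1}pE.
rewrite subr_eq0; apply/eqP=> x1; have /eqP := ol.
by rewrite (_ : l = 1%g) ?order1 //; apply: val_inj.
Qed.

Lemma ell_neqN1 : x + 1 != 0.
Proof.
rewrite addr_eq0; apply/eqP=> xN1; have := ell_root; rewrite xN1.
by apply/eqP; rewrite (_ : _ + _ = 1) ?oner_eq0 //; ring.
Qed.

End EllSpec.

(** * The four families of graphs *)

Lemma CGD1_normalizers (p : nat) (p_pr : prime p) (l : {unit 'F_p}) :
  ell_spec l ->
  let Gamma := Cay (CGD1_set (val l)) in
  let A := graph_aut Gamma in
  let R := right_regular (GD p 2) in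
  forall P : {group {perm GD p 2}}, P \in 'Syl_p(R) ->
  [/\ arc_transitive Gamma 'N_A(P),
      p = 5 ->
        exists2 K : {group {perm GD p 2}},
          R ><| K = 'N_A(R) & [Frobenius K] /\ #|K| = 20%N,
      (5 %| p.-1)%N ->
        exists2 K : {group {perm GD p 2}},
          R ><| K = 'N_A(R) & K \isog Zp 5
    & #|'N_A(P)| <> (20 * p ^ 2)%N].
Proof.
move=> l_spec Gamma A R P sylP; rewrite {}/A {}/Gamma.
have root := ell_root p_pr l_spec; rewrite (CGD1_setE root).
have isoQ := point_isog (CGD1_points_inj root) (CGD1_points0 _) (CGD1_basisE _).
have rotQ := CGD1_rot_sym root.
have sdp := sdprod_right_regular [set GD_point (CGD1_points (val l)) i | i : 'I_5].
have Frob : p = 5 -> [Frobenius (affine_sym (CGD1_points_inj root))] /\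
                     #|affine_sym (CGD1_points_inj root)| = 20.
  move=> p5; have l1 := ell_five l_spec p5; move: root rotQ {isoQ sdp}; rewrite l1.
  (* [p] and [l] become the literals 5 and 1, so that the lemmas over ['F_5] apply. *)
  move: p5 => ->{p p_pr l l_spec R P sylP l1} root rotQ.
  have fix01 := @CGD1_five_fix01 root; have dbl := CGD1_five_dbl_sym root.
  by split; [apply: rot5_dbl5_Frobenius | apply: rot5_dbl5_card].
have isoZ : 5 %| p.-1 -> affine_sym (CGD1_points_inj root) \isog Zp 5.
  move=> p5; apply: rot5_isog => // u uQ.
  by apply: (CGD1_fix0 p_pr _ _ _ _ _ uQ);
    rewrite ?(ell_odd p_pr) ?(ell_neq1 l_spec) ?(ell_neqN1 p_pr l_spec) ?(ell_nat_neq0 p_pr).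
split.
- exact: (point_arc_transitive p_pr rotQ sylP).
- move=> /Frob[FQ oQ]; exists (conn_aut [set GD_point (CGD1_points (val l)) i | i : 'I_5]) => //.
  split; last by rewrite (card_isog isoQ).
  have /isogP[f injf <-] : affine_sym (CGD1_points_inj root) \isog
    conn_aut [set GD_point (CGD1_points (val l)) i | i : 'I_5] by rewrite isog_sym.
  exact: injm_Frobenius_group.
- move=> /isoZ isoZ5; eexists; first exact: sdp.
  exact: isog_trans isoQ isoZ5.
case: (l_spec) => [[p5 _]|[p5 _]].
  (* For $p=5$, $|N_A(R(G))|=50\cdot 20=1000$ divides $|N_A(P)|$ but does not divide 500. *)
  move=> oN; have := cardSg (sub_norm_sylow p_pr
    [set GD_point (CGD1_points (val l)) i | i : 'I_5] sylP).
  rewrite /= oN card_norm_right_regular // (card_isog isoQ) (Frob p5).2.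
  by rewrite p5.
apply: card_norm_sylow_neq => //.
  by rewrite (card_isog isoQ) (card_isog (isoZ p5)) card_Zp.
rewrite Euclid_dvdM //= dvdn_prime2 //.
by apply: contraL p5 => /eqP <-.
Qed.

Lemma CGD2_normalizers (p : nat) (p_pr : prime p) (lambda : {unit 'F_p}) :
  (5 %| p.-1)%N || (5 %| p.+1)%N -> (val lambda ^+ 2 = 5%:R)%R ->
  let Gamma := Cay (CGD2_set (val lambda)) in
  let A := graph_aut Gamma in
  let R := right_regular (GD p 2) in
  forall P : {group {perm GD p 2}}, P \in 'Syl_p(R) ->
  [/\ arc_transitive Gamma 'N_A(P),
      exists2 K : {group {perm GD p 2}},
        R ><| K = 'N_A(R) & K \isog 'D_10
    & (20 * p ^ 2 %| #|'N_A(P)|)%N].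
Proof.
move=> p5 lambda2 Gamma A R P sylP; rewrite {}/A {}/Gamma CGD2_setE.
set m := (2%:R^-1 * (1 + val lambda))%R.
have p_odd : odd p.
  by have [p2|//] := even_prime p_pr; move: p5; rewrite p2.
have nat_neq0 q : prime q -> q != p -> (q%:R != 0 :> 'F_p)%R.
  by move=> q_pr; rewrite -(dvdn_pcharf (pchar_Fp p_pr)) dvdn_prime2 // eq_sym.
have two_neq0 : (2%:R != 0 :> 'F_p)%R.
  by rewrite nat_neq0 //; apply: contraL p_odd => /eqP <-.
have five_neq0 : (5%:R != 0 :> 'F_p)%R.
  by rewrite nat_neq0 //; apply: contraL p5 => /eqP <-.
have root : (m ^+ 2 = m + 1)%R.
  apply: (mulfI (expf_neq0 2 two_neq0)); rewrite /m exprMn mulrA -exprMn divff //.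
  by rewrite sqrrD lambda2; field.
have isoQ := point_isog (CGD2_points_inj root) (CGD2_points0 _) (CGD2_basisE _).
have isoD : conn_aut [set GD_point (CGD2_points m) i | i : 'I_5] \isog 'D_10.
  apply: isog_trans isoQ _; apply: rot5_flip5_isog.
  - exact: CGD2_rot_sym.
  - by move=> u uQ u0; have [_] := CGD2_fix0 p_pr five_neq0 p_odd uQ u0.
  - exact: CGD2_flip_sym.
  by move=> u uQ u0; have [] := CGD2_fix0 p_pr five_neq0 p_odd uQ u0.
split.
- exact: (point_arc_transitive p_pr (CGD2_rot_sym root) sylP).
- by eexists; first exact: sdprod_right_regular.
(* The divisor is $|N_A(R(G))|=2p^2\cdot 10$. *)
have := cardSg (sub_norm_sylow p_pr [set GD_point (CGD2_points m) i | i : 'I_5] sylP).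
apply: dvdn_trans; rewrite /= card_norm_right_regular // (card_isog isoD).
by rewrite (@card_dihedral 5) // mulnAC.
Qed.

Lemma CGD3_normalizers (p : nat) (p_pr : prime p) (l : {unit 'F_p}) :
  ell_spec l ->
  let Gamma := Cay (CGD3_set (val l)) in
  let A := graph_aut Gamma in
  let R := right_regular (GD p 3) in
  forall P : {group {perm GD p 3}}, P \in 'Syl_p(R) ->
  [/\ arc_transitive Gamma 'N_A(P),
      p = 5 ->
        exists2 K : {group {perm GD p 3}},
          R ><| K = 'N_A(R) & K \isog [set: 'S_5]
    & (5 %| p.-1)%N ->
        exists M K : {group {perm GD p 3}},
          [/\ R ><| K = M, K \isog Zp 5 & M \subset 'N_A(R)]].
Proof.
move=> l_spec Gamma A R P sylP; rewrite {}/A {}/Gamma.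
have root := ell_root p_pr l_spec; rewrite (CGD3_setE root).
have rotQ := CGD3_rot_sym root.
split.
- exact: (point_arc_transitive p_pr rotQ sylP).
- move=> p5; eexists; first exact: sdprod_right_regular.
  rewrite -(CGD3_sym_full root (ell_five l_spec p5)).
  exact: point_isog (CGD3_points0 _) (CGD3_basisE _).
by move=> _; apply: point_rotation_sdprod (CGD3_points0 _) (CGD3_basisE _) rotQ.
Qed.

Lemma CGD4_normalizers (p : nat) (p_pr : prime p) :
  let Gamma := Cay (CGD4_set p) in
  let A := graph_aut Gamma in
  let R := right_regular (GD p 4) in
  forall P : {group {perm GD p 4}}, P \in 'Syl_p(R) ->
  arc_transitive Gamma 'N_A(P) /\
  exists2 K : {group {perm GD p 4}},
    R ><| K = 'N_A(R) & K \isog [set: 'S_5].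
Proof.
move=> Gamma A R P sylP; rewrite {}/A {}/Gamma CGD4_setE; split.
  apply: (point_arc_transitive p_pr (v_inj := @CGD4_points_inj p)) sylP.
  by rewrite CGD4_sym_full inE.
eexists; first exact: sdprod_right_regular.
rewrite -(CGD4_sym_full p).
exact: point_isog (CGD4_points0 _) (@CGD4_basisE _).
Qed.

Theorem theorem3p1 (p : nat) (p_pr : prime p) :
  [/\ forall l : {unit 'F_p}, ell_spec l ->
        let Gamma := Cay (CGD1_set (val l)) in
        let A := graph_aut Gamma in
        let R := right_regular (GD p 2) in
        forall P : {group {perm GD p 2}}, P \in 'Syl_p(R) ->
        [/\ arc_transitive Gamma 'N_A(P),
            p = 5 ->
              exists2 K : {group {perm GD p 2}},
                R ><| K = 'N_A(R) & [Frobenius K] /\ #|K| = 20%N,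
            (5 %| p.-1)%N ->
              exists2 K : {group {perm GD p 2}},
                R ><| K = 'N_A(R) & K \isog Zp 5
          & #|'N_A(P)| <> (20 * p ^ 2)%N],
      forall lambda : {unit 'F_p}, (5 %| p.-1)%N || (5 %| p.+1)%N ->
        (val lambda ^+ 2 = 5%:R)%R ->
        let Gamma := Cay (CGD2_set (val lambda)) in
        let A := graph_aut Gamma in
        let R := right_regular (GD p 2) in
        forall P : {group {perm GD p 2}}, P \in 'Syl_p(R) ->
        [/\ arc_transitive Gamma 'N_A(P),
            exists2 K : {group {perm GD p 2}},
              R ><| K = 'N_A(R) & K \isog 'D_10
          & (20 * p ^ 2 %| #|'N_A(P)|)%N],
      forall l : {unit 'F_p}, ell_spec l ->
        let Gamma := Cay (CGD3_set (val l)) in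
        let A := graph_aut Gamma in
        let R := right_regular (GD p 3) in
        forall P : {group {perm GD p 3}}, P \in 'Syl_p(R) ->
        [/\ arc_transitive Gamma 'N_A(P),
            p = 5 ->
              exists2 K : {group {perm GD p 3}},
                R ><| K = 'N_A(R) & K \isog [set: 'S_5]
          & (5 %| p.-1)%N ->
              exists M K : {group {perm GD p 3}},
                [/\ R ><| K = M, K \isog Zp 5 & M \subset 'N_A(R)]]
    & let Gamma := Cay (CGD4_set p) in
      let A := graph_aut Gamma in
      let R := right_regular (GD p 4) in
      forall P : {group {perm GD p 4}}, P \in 'Syl_p(R) ->
      arc_transitive Gamma 'N_A(P) /\
      exists2 K : {group {perm GD p 4}},
        R ><| K = 'N_A(R) & K \isog [set: 'S_5]].
Proof.
split.
- exact: CGD1_normalizers.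
- exact: CGD2_normalizers.
- exact: CGD3_normalizers.
exact: CGD4_normalizers.
Qed.
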